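(* Let $G$ be a quantum graph. The Bloch spectrum $Spec_{Bl}(G)$ and the $\pi_1$-spectrum of $G$ are equal. There is a one-to-one correspondence $[\alpha]\mapsto\chi_\alpha$ between $H^1_{dR}(G,\mathbb{R})/H^1_{dR}(G,\mathbb{Z})$ and the set of characters $\chi:\pi_1(G)\to\mathbb{C}^*$ of $\pi_1(G)$. It is given by $\chi_\alpha(\gamma)=e^{-2\pi i\int_\gamma\alpha}$ for $\gamma\in\pi_1(G)$. It induces the equality $Spec(G,\chi_\alpha)=Spec_\alpha(G)$.
   Context: Combinatorial graphs are finite; loops and multiple edges are allowed, and a loop contributes $2$ to the degree of its vertex. All graphs are assumed connected, without isolated vertices and without vertices of degree $2$. A quantum graph $G$ is a combinatorial graph with vertex set $V$ and edge set $E$ together with a length function $L:E\to\mathbb{R}_{>0}$; each edge $e$ is identified with $[0,L(e)]$. Let $\nu_{v,e}$ be the outward unit normal of the edge $e$ at the vertex $v$; in sums over edges $e\sim v$ adjacent to $v$ a loop contributes at both ends. $\Lambda^0$ is the space of continuous functions $f$ on $G$, smooth on each closed edge, with $\sum_{e\sim v}\nu_{v,e}(f|_e)=0$ at all $v$ (Kirchhoff condition). $\Lambda^1$ is the space of $1$-forms $\alpha$, consisting of a smooth $1$-form $\alpha_e$ on each closed edge with $\sum_{e\sim v}\alpha_e(\nu_{v,e})=0$ at all $v$. $H^1_{dR}(G,\mathbb{R})$ is the space of real $1$-forms modulo differentials of real $0$-forms, and $H^1_{dR}(G,\mathbb{Z})$ is the lattice of classes whose integrals over all closed walks are integers. For a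 real $1$-form $\alpha$, written $\alpha_e=a_e\,dx$ in an arclength parameter, $\Delta_\alpha=d_\alpha^*d_\alpha$ with $d_\alpha=d+2\pi i\alpha$ acts on each edge as $f\mapsto-\left(\frac{d}{dx}+2\pi i a_e\right)^2f$, with domain all continuous $f$ on $G$ lying in the Sobolev space $W_2$ (two derivatives in $L^2$) on each edge and satisfying $\sum_{e\sim v}\nu_{v,e}(f|_e)=0$ at every $v$. $Spec_\alpha(G)$ is the set of eigenvalues of $\Delta_\alpha$ including multiplicities; it depends only on the coset of $[\alpha]$ in $H^1_{dR}(G,\mathbb{R})/H^1_{dR}(G,\mathbb{Z})$, and the Bloch spectrum $Spec_{Bl}(G)$ is the map $[\alpha]\mapsto Spec_\alpha(G)$ on this quotient. Let $\tilde G$ be the universal cover of $G$ (with lifted edge lengths), on which the fundamental group $\pi_1(G)$ acts by deck transformations, so that the path in $\tilde G$ from $x$ to $\gamma x$ projects to a closed loop in $G$ over which $\int_\gamma\alpha$ is computed. A character of $\pi_1(G)$ is a homomorphism $\chi:\pi_1(G)\to\mathbb{C}^*$. For a character $\chi$ let $\Lambda^0_\chi(\tilde G)$ be the space of functions $\tilde f:\tilde G\to\mathbb{C}$ that are continuous (and smooth on edges), satisfy the Kirchhoff conditions at all vertices, and satisfy $\tilde f(\gamma x)=\chi(\gamma)\tilde f(x)$ for all $x\in\tilde G$, $\gamma\in\pi_1(G)$. $Spec(G,\chi)$ is the spectrum (eigenvalues with multiplicities) of the standard Laplacian $d^*d$ (i.e. $-\frac{d^2}{dx^2}$ on each edge)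 on $\tilde G$ restricted to $\Lambda^0_\chi(\tilde G)$. The $\pi_1$-spectrum of $G$ is the map that associates to each character $\chi$ of $\pi_1(G)$ the spectrum $Spec(G,\chi)$.
   Formalization: The correspondence is stated onto the unitary characters (|χ(γ)| = 1 for all γ) instead of all homomorphisms to C^*, because e^{-2πi∫_γ α} with α real has modulus 1, so a character with χ(γ) = 2, which exists whenever G has a cycle, is never reached. *)

(* Defs.v *)
From HB Require Import structures.
From mathcomp Require Import all_boot all_order all_algebra finmap.
From mathcomp Require Import all_classical all_reals all_analysis.
From mathcomp Require Import complex.

Set Implicit Arguments.
Unset Strict Implicit.
Unset Printing Implicit Defensive.

Import Order.TTheory GRing.Theory Num.Theory.
Import numFieldNormedType.Exports.

Local Open Scope classical_set_scope.
Local Open Scope ring_scope.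

Section Calculus.
Context {R : realType}.
Implicit Types (A : set R) (f g : R -> R) (L x : R).

(* Derivative relative to A: at an end point of A = [0, L] this is the
   one-sided derivative. *)
Definition diff_quot f x : R -> R := fun y => (f y - f x) / (y - x).

Definition derivable_on A f x := cvg (diff_quot f x y @[y --> within A x^']).

Definition derive_on A f x : R := lim (diff_quot f x y @[y --> within A x^']).

(* C^oo on A, up to and including the end points *)
Definition smooth_on A f :=
  forall n x, A x -> derivable_on A (iter n (derive_on A) f) x.

(* f belongs to H^1([0, L]) with weak derivative g: in dimension one this means
   that f is absolutely continuous, the integral of g in L^2([0, L]). *)
Definition W1_on L f g :=
  (g \_ `[0, L]) \in Lfun lebesgue_measure 2%:E /\
  forall x, x \in `[0, L] -> f x = f 0 + \int[lebesgue_measure]_(t in `[0, x]) g t.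

Definition W2_on L f := exists f1 f2, W1_on L f f1 /\ W1_on L f1 f2.

Lemma within_itv_proper L x : 0 < L -> `[0, L]%classic x ->
  ProperFilter (within `[0, L] x^').
Proof.
move=> L0 /=; rewrite in_itv/= => /andP[x0 xL].
apply: Build_ProperFilter_ex => P.
rewrite /within /dnbhs /within/= => /nbhs_ballP[e /= e0 He].
case: (ltP x L) => xL'.
  pose y := Num.min L (x + e / 2).
  have xy : x < y by rewrite /y lt_min xL' ltrDl divr_gt0.
  exists y; apply: (He y) => /=.
  - rewrite -ball_normE/= distrC ger0_norm ?subr_ge0 ?ltW// ltrBlDl /y gt_min; apply/orP.
    by right; rewrite ltrD2l ltr_pdivrMr// ltr_pMr// ltr1n.
  - by rewrite gt_eqF.
  - by rewrite in_itv/= (le_trans x0 (ltW xy))/= /y ge_min lexx.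
have xE : x = L by apply/eqP; rewrite eq_le xL xL'.
rewrite {}xE in He *.
have {}He y : `|L - y| < e -> y != L -> y \in `[0, L] -> P y.
  by move=> yx yL; apply: He => /=; rewrite -?ball_normE.
pose y := Num.max 0 (L - e / 2).
have yL : y < L by rewrite /y gt_max L0 gtrBl divr_gt0.
exists y; apply: He.
- rewrite ger0_norm ?subr_ge0 ?ltW// ltrBlDl -ltrBlDr /y lt_max; apply/orP.
  by right; rewrite ltrD2l ltrN2 ltr_pdivrMr// ltr_pMr// ltr1n.
- by rewrite lt_eqF.
- by rewrite in_itv/= (ltW yL) andbT /y le_max lexx.
Qed.

Lemma near_within_in A x : \forall y \near within A x^', A y.
Proof. exact: withinT. Qed.

Lemma eq_diff_quot A f g x : A x -> {in A, f =1 g} ->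
  \forall y \near within A x^', diff_quot f x y = diff_quot g x y.
Proof.
move=> Ax fg; near=> y; rewrite /diff_quot !fg ?inE//.
by near: y; exact: near_within_in.
Unshelve. all: by end_near. Qed.

Lemma eq_derivable_on A f g x : A x -> {in A, f =1 g} ->
  derivable_on A f x -> derivable_on A g x.
Proof.
move=> Ax fg /cvg_ex[l fl]; apply/cvg_ex; exists l.
apply: cvg_trans fl; apply: near_eq_cvg.
by apply: filterS (eq_diff_quot Ax fg) => y ->.
Qed.

Lemma derive_onB L f g x : 0 < L -> `[0, L]%classic x ->
  derivable_on `[0, L] f x -> derivable_on `[0, L] g x ->
  derivable_on `[0, L] (f - g) x /\
  derive_on `[0, L] (f - g) x = derive_on `[0, L] f x - derive_on `[0, L] g x.
Proof.
move=> L0 Ax df dg.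
have PF := within_itv_proper L0 Ax.
have E : diff_quot (f - g) x = diff_quot f x \- diff_quot g x.
  apply/funext => y; rewrite /diff_quot /= -mulrBl; congr (_ / _).
  by rewrite !fctE !opprB addrACA [RHS]addrACA [- f x - g y]addrC.
rewrite /derivable_on /derive_on E; split; first exact: is_cvgB.
by apply: cvg_lim => //; exact: cvgB.
Qed.

Lemma eq_derive_on L f g x : 0 < L -> `[0, L]%classic x ->
  {in `[0, L]%classic, f =1 g} -> derivable_on `[0, L] f x ->
  derive_on `[0, L] g x = derive_on `[0, L] f x.
Proof.
move=> L0 Ax fg df; have PF := within_itv_proper L0 Ax.
apply: cvg_lim => //; apply: cvg_trans df; apply: near_eq_cvg.
by apply: filterS (eq_diff_quot Ax fg) => y ->.
Qed.

Lemma smooth_onB L f g : 0 < L -> smooth_on `[0, L] f -> smooth_on `[0, L] g ->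
  smooth_on `[0, L] (f - g).
Proof.
move=> L0 sf sg.
suff H n : {in `[0, L]%classic, iter n (derive_on `[0, L]) f -
             iter n (derive_on `[0, L]) g =1
             iter n (derive_on `[0, L]) (f - g)}.
  move=> n x Ax; apply: (eq_derivable_on Ax (H n)).
  exact: (derive_onB L0 Ax (sf n x Ax) (sg n x Ax)).1.
elim: n => [//|n IH] x /set_mem Ax.
have [d dE] := derive_onB L0 Ax (sf n x Ax) (sg n x Ax).
by rewrite [RHS]/= (eq_derive_on L0 Ax IH d) dE.
Qed.

Lemma derive_on0 L x : 0 < L -> `[0, L]%classic x ->
  derivable_on `[0, L] 0 x /\ derive_on `[0, L] 0 x = 0.
Proof.
move=> L0 Ax; have PF := within_itv_proper L0 Ax.
have d0 : diff_quot 0 x y @[y --> within `[0, L] x^'] --> (0 : R).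
  rewrite (_ : diff_quot 0 x = cst 0); first exact: cvg_cst.
  by apply/funext => y; rewrite /diff_quot /= subrr mul0r.
by split; [apply/cvg_ex; exists 0 | exact: cvg_lim].
Qed.

Lemma smooth_on0 L : 0 < L -> smooth_on `[0, L] 0.
Proof.
move=> L0; suff H n : {in `[0, L]%classic, 0 =1 iter n (derive_on `[0, L]) 0}.
  by move=> n x Ax; apply: (eq_derivable_on Ax (H n)); exact: (derive_on0 L0 Ax).1.
elim: n => [//|n IH] x /set_mem Ax; have [d dE] := derive_on0 L0 Ax.
by rewrite [RHS]/= (eq_derive_on L0 Ax IH d) dE.
Qed.

Lemma derivable_on_continuous L f : 0 < L ->
  (forall x, `[0, L]%classic x -> derivable_on `[0, L] f x) ->
  {within `[0, L], continuous f}.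
Proof.
move=> L0 df; apply/subspace_continuousP => x Ax.
have PF := within_itv_proper L0 Ax.
have fx : f y @[y --> within `[0, L] x^'] --> f x.
  have -> : f = (fun y => f x + (y - x) * diff_quot f x y).
    apply/funext => y; rewrite /diff_quot; have [->|yx] := eqVneq y x.
      by rewrite subrr mul0r addr0.
    by rewrite mulrC divfK ?subr_eq0// addrC subrK.
  rewrite -[X in _ --> X](_ : f x + (x - x) * derive_on `[0, L] f x = _); last first.
    by rewrite subrr !mul0r !addr0.
  apply: cvgD; first exact: cvg_cst.
  apply: cvgM; last exact: df.
  apply: cvgB; last exact: cvg_cst.
  by move=> P /= Px; apply: filterS Px => y Py _ _.
apply/cvgrPdist_lt => e e0.
move/cvgrPdist_lt : fx => /(_ e e0).
rewrite !near_withinE => fx; apply: filterS fx => y H Ay.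
have [->|yx] := eqVneq y x; first by rewrite subrr normr0.
exact: H.
Qed.

End Calculus.

(* A dart is an edge with a direction of traversal: (e, true) runs from the
   end point 0 of e to the end point L(e), and (e, false) backwards. *)
Section Reduction.
Context {E : eqType}.
Local Notation dart := (E * bool)%type.
Implicit Types (d : dart) (p q r : seq dart).

Definition rev_dart d : dart := (d.1, ~~ d.2).

Definition reduced p := sorted (fun d d' => d' != rev_dart d) p.

Definition push d p :=
  if p is d' :: p' then if d' == rev_dart d then p' else d :: p else [:: d].

Definition reduce p : seq dart := foldr push [::] p.

Definition rev_walk p : seq dart := rev (map rev_dart p).

Lemma rev_dartK : involutive rev_dart.
Proof. by case=> e b; rewrite /rev_dart/= negbK. Qed.

Lemma push_reduced d p : reduced p -> reduced (push d p).
Proof.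
case: p => [//|d' p] /= rp; case: ifPn => [_|nd]; first exact: path_sorted rp.
by rewrite /= nd.
Qed.

Lemma foldr_push_reduced p r : reduced r -> reduced (foldr push r p).
Proof. by move=> rr; elim: p => //= d p; exact: push_reduced. Qed.

Lemma reduce_reduced p : reduced (reduce p).
Proof. exact: foldr_push_reduced. Qed.

Lemma push_id d p : reduced (d :: p) -> push d p = d :: p.
Proof. by case: p => //= d' p /andP[/negPf ->]. Qed.

Lemma reduce_id p : reduced p -> reduce p = p.
Proof.
elim: p => // d p IH rdp.
by rewrite -[LHS]/(push d (reduce p)) (IH (path_sorted rdp)) push_id.
Qed.

Lemma pushK d p : reduced p -> push d (push (rev_dart d) p) = p.
Proof.
case: p => [|d' p] rp /=; first by rewrite eqxx.
rewrite rev_dartK; have [dd|nd] := eqVneq d' d; last by rewrite /= eqxx.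
by rewrite -dd -[RHS](push_id rp).
Qed.

Lemma foldr_reduce p r : reduced r -> foldr push r (reduce p) = foldr push r p.
Proof.
move=> rr; elim: p => //= d p <-.
case: (reduce p) => //= d' q; case: eqVneq => //= ->.
by rewrite pushK//; exact: foldr_push_reduced.
Qed.

Lemma reduce_catl p q : reduce (reduce p ++ q) = reduce (p ++ q).
Proof.
rewrite /reduce !foldr_cat; exact: (foldr_reduce p (reduce_reduced q)).
Qed.

Lemma reduce_catr p q : reduce (p ++ reduce q) = reduce (p ++ q).
Proof. by rewrite /reduce !foldr_cat -/(reduce _) (reduce_id (reduce_reduced q)). Qed.

Lemma rev_walkK : involutive rev_walk.
Proof.
by move=> p; rewrite /rev_walk map_rev revK -map_comp map_id_in// => d _ /=;
  rewrite rev_dartK.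
Qed.

Lemma reduce_rev_walk p : reduce (rev_walk p ++ p) = [::].
Proof.
elim: p => // d p IH.
rewrite /rev_walk map_cons rev_cons cat_rcons -[RHS]IH /reduce !foldr_cat.
by have := pushK (rev_dart d) (reduce_reduced p); rewrite rev_dartK => /= ->.
Qed.

End Reduction.

(* Locally finite graphs, loops and multiple edges allowed, whose edge e is
   identified with [0, len e], 0 lying over src e and len e over tgt e. *)
Record metricGraph (R : realType) := MetricGraph {
  vertex : choiceType;
  edge : choiceType;
  src : edge -> vertex;
  tgt : edge -> vertex;
  len : edge -> R;
  len_gt0 : forall e, 0 < len e;
  star_finite : forall v,
    finite_set [set d : edge * bool | (if d.2 then src d.1 else tgt d.1) = v]
}.

Section MetricGraph.
Context {R : realType} (G : metricGraph R).
Implicit Types (v w : vertex G) (e : edge G).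

Definition dart : choiceType := (edge G * bool)%type.

Implicit Types (d : dart) (p : seq dart).

Definition dsrc d := if d.2 then src d.1 else tgt d.1.
Definition dtgt d := if d.2 then tgt d.1 else src d.1.

Definition star v : set dart := [set d | dsrc d = v].

(* A loop contributes two darts, hence 2 to the degree. *)
Definition degree v := (#|` fset_set (star v)|)%fset.

Fixpoint walk v p : bool :=
  if p is d :: p' then (dsrc d == v) && walk (dtgt d) p' else true.

Definition walk_end v p := last v (map dtgt p).

(* the coordinate in [0, len e] of the end of the edge at which d starts, and
   the outward unit normal of the edge there, as a multiple of d/dx *)
Definition endpoint d : R := if d.2 then 0 else len d.1.
Definition normal d : R := if d.2 then -1 else 1.

(* A function on G is given by its restrictions to the closed edges; only the
   values of f e on [0, len e] are meaningful. *)
Definition gfun := edge G -> R -> R.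
Definition cgfun := edge G -> R -> R[i].
Implicit Types (f g a : gfun) (h : cgfun).

Definition ederive f : gfun := fun e => derive_on `[0, len e] (f e).

Definition continuous_on_graph f :=
  (forall e, {within `[0, len e], continuous (f e)}) /\
  (forall d d', dsrc d = dsrc d' ->
     f d.1 (endpoint d) = f d'.1 (endpoint d')).

Definition smooth_on_edges f := forall e, smooth_on `[0, len e] (f e).

Definition kirchhoff f :=
  forall v, \sum_(d \in star v) normal d * ederive f d.1 (endpoint d) = 0.

Definition zero_form f :=
  [/\ continuous_on_graph f, smooth_on_edges f & kirchhoff f].

Definition W2_domain f :=
  [/\ continuous_on_graph f, forall e, W2_on (len e) (f e) & kirchhoff f].

(* A complex valued function belongs to these real-linear spaces when its real
   and imaginary parts do, and d/dx acts on the two parts separately. *)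
Definition re_part h : gfun := fun e x => complex.Re (h e x).
Definition im_part h : gfun := fun e x => complex.Im (h e x).

Definition czero_form h := zero_form (re_part h) /\ zero_form (im_part h).
Definition cW2_domain h := W2_domain (re_part h) /\ W2_domain (im_part h).

Definition cderive h : cgfun :=
  fun e x => (ederive (re_part h) e x +i* ederive (im_part h) e x)%C.

(* the 1-form with restriction a e dx to the edge e *)
Definition is_one_form a :=
  smooth_on_edges a /\
  forall v, \sum_(d \in star v) normal d * a d.1 (endpoint d) = 0.

Definition lin_independent n (h : 'I_n -> cgfun) :=
  forall c : 'I_n -> R[i],
    (forall e x, x \in `[0, len e] -> \sum_(i < n) c i * h i e x = 0) ->
    forall i, c i = 0.

Definition dimension (S : set cgfun) : \bar R :=
  ereal_sup [set (n%:R)%:E | n in [set n | exists h : 'I_n -> cgfun,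
    (forall i, S (h i)) /\ lin_independent h]].

Definition dart_integral a d : R :=
  (if d.2 then 1 else -1) *
  \int[lebesgue_measure]_(x in `[0, len d.1]) a d.1 x.

Definition walk_integral a p : R := \sum_(d <- p) dart_integral a d.

Definition covariant_derive a h : cgfun :=
  fun e x => cderive h e x + (2 * pi * a e x)%:C%C * 'i%C * h e x.

End MetricGraph.

Arguments gfun {R} G.
Arguments cgfun {R} G.

(* A spectrum is recorded as the function sending a number to its multiplicity
   as an eigenvalue, which is 0 when it is not an eigenvalue. *)
Definition spectrum (R : realType) := R[i] -> \bar R.

Record quantumGraph (R : realType) := QuantumGraph {
  qgraph :> metricGraph R;
  vertex_finite : finite_set [set: vertex qgraph];
  edge_finite : finite_set [set: edge qgraph];
  qconnected : forall v w : vertex qgraph,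
    exists p, walk v p && (walk_end v p == w);
  no_isolated_vertex : forall v : vertex qgraph, degree v <> 0%N;
  no_degree2_vertex : forall v : vertex qgraph, degree v <> 2%N
}.

Section Cohomology.
Context {R : realType} (G : metricGraph R).

Definition one_form_pred : {pred gfun G} := [pred a | `[< is_one_form a >]].

Lemma one_form_zmod_closed : zmod_closed one_form_pred.
Proof.
split.
  apply/asboolP; split=> [e|v]; first exact: smooth_on0 (len_gt0 e).
  by apply: fsbig1 => d _; rewrite mulr0.
move=> a b /asboolP[sa ka] /asboolP[sb kb]; apply/asboolP; split=> [e|v].
  exact: smooth_onB (len_gt0 e) (sa e) (sb e).
rewrite (eq_fsbigr (fun d => normal d * a d.1 (endpoint d) +
    - 1 * (normal d * b d.1 (endpoint d)))); last first.
  by move=> d _; rewrite mulN1r -mulrBr.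
rewrite fsbig_split/=; last exact: star_finite.
by rewrite -mulr_fsumr ka kb mulr0 addr0.
Qed.

HB.instance Definition _ :=
  GRing.isZmodClosed.Build (gfun G) one_form_pred one_form_zmod_closed.

Definition one_form := {a : gfun G | a \in one_form_pred}.
HB.instance Definition _ := SubChoice.on one_form.
HB.instance Definition _ := [SubChoice_isSubZmodule of one_form by <:].

Lemma walk_integral0 p : walk_integral (0 : gfun G) p = 0.
Proof.
rewrite /walk_integral big1// => d _; rewrite /dart_integral.
by rewrite /Rintegral integral0_eq// fine0 mulr0.
Qed.

Lemma one_form_integrable (a : one_form) e :
  lebesgue_measure.-integrable `[0, len e] (EFin \o (val a) e).
Proof.
have /asboolP[sa _] := valP a.
apply: continuous_compact_integrable; first exact: segment_compact.
exact: derivable_on_continuous (len_gt0 e) (sa e 0%N).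
Qed.

Lemma walk_integralB (a b : one_form) p :
  walk_integral (val (a - b)) p = walk_integral (val a) p - walk_integral (val b) p.
Proof.
rewrite /walk_integral -sumrB; apply: eq_bigr => d _.
rewrite /dart_integral -mulrBr; congr (_ * _).
by rewrite -RintegralB//; exact: one_form_integrable.
Qed.

Lemma ederiveB (f g : gfun G) e x : smooth_on_edges f -> smooth_on_edges g ->
  x \in `[0, len e] -> ederive (f - g) e x = ederive f e x - ederive g e x.
Proof.
by move=> sf sg xe; exact: (derive_onB (len_gt0 e) xe (sf e 0%N x xe) (sg e 0%N x xe)).2.
Qed.

Lemma endpoint_in (d : dart G) : endpoint d \in `[0, len d.1].
Proof.
by rewrite /endpoint; case: d.2; rewrite in_itv/= lexx ltW// len_gt0.
Qed.

Lemma zero_form0 : zero_form (0 : gfun G).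
Proof.
split; [split=> [e|//]| |].
- by move=> x; exact: cst_continuous.
- by move=> e; exact: smooth_on0 (len_gt0 e).
- move=> v; apply: fsbig1 => d _.
  by rewrite /ederive (derive_on0 (len_gt0 _) (endpoint_in d)).2 mulr0.
Qed.

Lemma zero_formB (f g : gfun G) : zero_form f -> zero_form g -> zero_form (f - g).
Proof.
move=> [[cf vf] sf kf] [[cg vg] sg kg]; split; [split=> [e|d d' dd']| |].
- by move=> x; apply: continuousB; [exact: cf|exact: cg].
- by rewrite !fctE (vf _ _ dd') (vg _ _ dd').
- by move=> e; exact: smooth_onB (len_gt0 e) (sf e) (sg e).
- move=> v; rewrite (eq_fsbigr (fun d => normal d * ederive f d.1 (endpoint d) +
    - 1 * (normal d * ederive g d.1 (endpoint d)))); last first.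
    by move=> d _; rewrite mulN1r -mulrBr ederiveB// endpoint_in.
  rewrite fsbig_split/=; last exact: star_finite.
  by rewrite -mulr_fsumr kf kg mulr0 addr0.
Qed.

Definition exact_pred : {pred one_form} := [pred a : one_form | `[<
  exists2 f : gfun G, zero_form f &
    forall e x, x \in `[0, len e] -> (val a) e x = ederive f e x >]].

Lemma exact_zmod_closed : zmod_closed exact_pred.
Proof.
split.
  apply/asboolP; exists 0; first exact: zero_form0.
  by move=> e x xe; rewrite /ederive (derive_on0 (len_gt0 e) _).2.
move=> a b /asboolP[f zf af] /asboolP[g zg bg]; apply/asboolP.
exists (f - g); first exact: zero_formB.
move=> e x xe; have [_ sf _] := zf; have [_ sg _] := zg.
by rewrite ederiveB// -af// -bg.
Qed.

HB.instance Definition _ :=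
  GRing.isZmodClosed.Build one_form exact_pred exact_zmod_closed.

Definition H1dR : zmodType := Quotient.quot exact_pred.

Definition dR_class (a : one_form) : H1dR := \pi_H1dR%qT a.

(* Integrals over closed walks do not depend on the representative. *)
Definition H1dR_int : {pred H1dR} := [pred c : H1dR | `[<
  exists2 a : one_form, dR_class a = c &
    forall v p, walk v p -> walk_end v p = v ->
      walk_integral (val a) p \is a Num.int >]].

Lemma H1dR_int_zmod_closed : zmod_closed H1dR_int.
Proof.
split.
  apply/asboolP; exists 0; first exact: raddf0.
  by move=> v p _ _; rewrite walk_integral0 rpred0.
move=> _ _ /asboolP[a <- ia] /asboolP[b <- ib]; apply/asboolP.
exists (a - b); first exact: raddfB.
by move=> v p wp ep; rewrite walk_integralB rpredB// ?ia ?ib//; eauto.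
Qed.

HB.instance Definition _ :=
  GRing.isZmodClosed.Build H1dR H1dR_int H1dR_int_zmod_closed.

Definition dR_torus : zmodType := Quotient.quot H1dR_int.

Definition torus_class (a : one_form) : dR_torus := \pi_dR_torus%qT (dR_class a).

End Cohomology.

Section Bloch.
Context {R : realType} (G : metricGraph R).

(* Elements of W_2 have a second derivative almost everywhere only. *)
Definition bloch_eigenspace (a : one_form G) (l : R[i]) : set (cgfun G) :=
  [set h | cW2_domain h /\ forall e,
    {ae lebesgue_measure, forall x, x \in `[0, len e] ->
      - covariant_derive (val a) (covariant_derive (val a) h) e x = l * h e x}].

Definition form_spectrum (a : one_form G) : spectrum R :=
  fun l => dimension (bloch_eigenspace a l).

(* Read off a chosen representative of each class. *)
Definition bloch_spectrum (c : dR_torus G) : spectrum R :=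
  form_spectrum (repr (repr c)).

End Bloch.

Section FundamentalGroup.
Context {R : realType} (G : metricGraph R).
Implicit Types (v : vertex G) (d : dart G) (p q : seq (dart G)).

Lemma dsrc_rev d : dsrc (rev_dart d) = dtgt d.
Proof. by case: d => e []. Qed.

Lemma dtgt_rev d : dtgt (rev_dart d) = dsrc d.
Proof. by case: d => e []. Qed.

Lemma walk_cat v p q : walk v (p ++ q) = walk v p && walk (walk_end v p) q.
Proof. by elim: p v => //= d p IH v; rewrite IH andbA. Qed.

Lemma walk_end_cat v p q : walk_end v (p ++ q) = walk_end (walk_end v p) q.
Proof. by rewrite /walk_end map_cat last_cat. Qed.

Lemma push_walk v d p : walk v (d :: p) ->
  walk v (push d p) /\ walk_end v (push d p) = walk_end v (d :: p).
Proof.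
case: p => [|d' p]//; rewrite /push; case: eqVneq => [->|//].
by rewrite /walk_end/= dtgt_rev => /and3P[/eqP <-].
Qed.

Lemma reduce_walk v p : walk v p ->
  walk v (reduce p) /\ walk_end v (reduce p) = walk_end v p.
Proof.
elim: p v => // d p IH v /= /andP[dv /IH[wp ep]].
have [|w e] := @push_walk v d (reduce p); first by rewrite /= dv.
by split=> //; rewrite -[LHS]/(walk_end v (push d (reduce p))) e; exact: ep.
Qed.

Lemma rev_walk_walk v p : walk v p ->
  walk (walk_end v p) (rev_walk p) /\ walk_end (walk_end v p) (rev_walk p) = v.
Proof.
elim: p v => // d p IH v /= /andP[/eqP dv /IH[wp ep]].
rewrite /rev_walk map_cons rev_cons -cats1 walk_cat walk_end_cat.
rewrite -/(rev_walk p) -[walk_end v (d :: p)]/(walk_end (dtgt d) p) wp ep/=.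
by rewrite dsrc_rev eqxx /walk_end/= dtgt_rev.
Qed.

Variable v0 : vertex G.

Definition closed_reduced p := [&& walk v0 p, walk_end v0 p == v0 & reduced p].

(* Each homotopy class of loops at v0 contains exactly one closed edge walk
   without backtracking. *)
Definition fundamental_group := {p : seq (dart G) | closed_reduced p}.
HB.instance Definition _ := SubChoice.on fundamental_group.

Lemma fg_mul_subproof (g h : fundamental_group) :
  closed_reduced (reduce (val g ++ val h)).
Proof.
have /and3P[wg /eqP eg _] := valP g; have /and3P[wh /eqP eh _] := valP h.
have [|w e] := @reduce_walk v0 (val g ++ val h).
  by rewrite walk_cat wg eg.
by rewrite /closed_reduced w e walk_end_cat eg eh eqxx reduce_reduced.
Qed.

Lemma fg_inv_subproof (g : fundamental_group) :
  closed_reduced (reduce (rev_walk (val g))).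
Proof.
have /and3P[wg /eqP eg _] := valP g; have [] := rev_walk_walk wg.
rewrite eg => wr er; have [w e] := reduce_walk wr.
by rewrite /closed_reduced w e er eqxx reduce_reduced.
Qed.

Lemma fg_one_subproof : closed_reduced [::].
Proof. by rewrite /closed_reduced /walk_end/= eqxx. Qed.

Definition fg_one : fundamental_group := Sub [::] fg_one_subproof.
Definition fg_mul g h : fundamental_group :=
  Sub (reduce (val g ++ val h)) (fg_mul_subproof g h).
Definition fg_inv g : fundamental_group :=
  Sub (reduce (rev_walk (val g))) (fg_inv_subproof g).

Lemma fg_reduce_id (g : fundamental_group) : reduce (val g) = val g.
Proof. by apply: reduce_id; case/and3P: (valP g). Qed.

Lemma fg_mulA : associative fg_mul.
Proof.
by move=> g h k; apply: val_inj; rewrite !SubK reduce_catl reduce_catr catA.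
Qed.

Lemma fg_mul1 : left_id fg_one fg_mul.
Proof. by move=> g; apply: val_inj; rewrite !SubK fg_reduce_id. Qed.

Lemma fg_mulr1 : right_id fg_one fg_mul.
Proof. by move=> g; apply: val_inj; rewrite !SubK cats0 fg_reduce_id. Qed.

Lemma fg_mulV : left_inverse fg_one fg_inv fg_mul.
Proof.
by move=> g; apply: val_inj; rewrite !SubK reduce_catl reduce_rev_walk.
Qed.

Lemma fg_mulrV : right_inverse fg_one fg_inv fg_mul.
Proof.
move=> g; apply: val_inj; rewrite !SubK reduce_catr.
by rewrite -{1}[val g]rev_walkK reduce_rev_walk.
Qed.

HB.instance Definition _ :=
  isGroup.Build fundamental_group fg_mulA fg_mul1 fg_mulr1 fg_mulV fg_mulrV.

(* The vertices of the universal cover are the walks from v0 without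
   backtracking, the vertex p lying over walk_end v0 p. *)
Definition cover_walk p := walk v0 p && reduced p.
Definition cover_vertex := {p : seq (dart G) | cover_walk p}.
HB.instance Definition _ := SubChoice.on cover_vertex.

(* The edge (p, e) is the lift of e starting at the vertex p, which lies over
   the end point 0 of e. *)
Definition is_cover_edge (pe : cover_vertex * edge G) :=
  walk_end v0 (val pe.1) == src pe.2.
Definition cover_edge := {pe : cover_vertex * edge G | is_cover_edge pe}.
HB.instance Definition _ := SubChoice.on cover_edge.

Definition cover_src (pe : cover_edge) : cover_vertex := (val pe).1.

Lemma cover_tgt_subproof (pe : cover_edge) :
  cover_walk (reduce (rcons (val (cover_src pe)) ((val pe).2, true))).
Proof.
have /andP[wp _] := valP (cover_src pe).
have [|w _] := @reduce_walk v0 (rcons (val (cover_src pe)) ((val pe).2, true)).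
  by rewrite -cats1 walk_cat wp/= andbT /dsrc/= eq_sym; exact: (valP pe).
by rewrite /cover_walk w reduce_reduced.
Qed.

Definition cover_tgt (pe : cover_edge) : cover_vertex :=
  Sub (reduce (rcons (val (cover_src pe)) ((val pe).2, true)))
      (cover_tgt_subproof pe).

Definition cover_len (pe : cover_edge) : R := len (val pe).2.

Lemma cover_len_gt0 pe : 0 < cover_len pe.
Proof. exact: len_gt0. Qed.

Definition cover_proj_dart (d : cover_edge * bool) : dart G :=
  ((val d.1).2, d.2).

Lemma cover_tgtK (pe : cover_edge) :
  reduce (rcons (val (cover_tgt pe)) ((val pe).2, false)) = val (cover_src pe).
Proof.
have /andP[_ rp] := valP (cover_src pe).
rewrite SubK -!cats1 reduce_catl -catA -reduce_catr/= eqxx cats0.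
exact: reduce_id.
Qed.

Lemma cover_star_finite (w : cover_vertex) :
  finite_set [set d : cover_edge * bool |
    (if d.2 then cover_src d.1 else cover_tgt d.1) = w].
Proof.
set S := [set _ | _].
have injS : set_inj S cover_proj_dart.
  move=> [pe b] [qf c] /set_mem/= Sp /set_mem/= Sq [ef bc].
  congr pair => //; rewrite -{c}bc in Sq; apply: val_inj.
  suff E : cover_src pe = cover_src qf.
    by rewrite [LHS]surjective_pairing [RHS]surjective_pairing ef; congr pair.
  case: b Sp Sq => /= Sp Sq; first exact: etrans Sp (esym Sq).
  apply: val_inj.
  by rewrite -!cover_tgtK ef; congr (reduce (rcons (val _) _)); exact: etrans Sp (esym Sq).
rewrite -(eq_finite_set (inj_card_eq injS)).
apply: sub_finite_set (star_finite (walk_end v0 (val w))).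
move=> _ [[pe []] /= <-] <- /=; first by rewrite (eqP (valP pe)).
have /andP[wp _] := valP (cover_src pe).
have [|_ ->] := @reduce_walk v0 (rcons (val (cover_src pe)) ((val pe).2, true)).
  by rewrite -cats1 walk_cat wp/= andbT /dsrc/= eq_sym; exact: (valP pe).
by rewrite -cats1 walk_end_cat.
Qed.

Definition universal_cover : metricGraph R :=
  MetricGraph cover_len_gt0 cover_star_finite.

Lemma deck_vertex_subproof (g : fundamental_group) (p : cover_vertex) :
  cover_walk (reduce (val g ++ val p)).
Proof.
have /and3P[wg /eqP eg _] := valP g; have /andP[wp _] := valP p.
have [|w _] := @reduce_walk v0 (val g ++ val p); first by rewrite walk_cat wg eg.
by rewrite /cover_walk w reduce_reduced.
Qed.

(* Deck transformations: pi_1 acts on the walks from v0 by left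
   multiplication. *)
Definition deck_vertex (g : fundamental_group) (p : cover_vertex) : cover_vertex :=
  Sub (reduce (val g ++ val p)) (deck_vertex_subproof g p).

Lemma deck_edge_subproof (g : fundamental_group) (pe : cover_edge) :
  is_cover_edge (deck_vertex g (cover_src pe), (val pe).2).
Proof.
have /and3P[wg /eqP eg _] := valP g; have /andP[wp _] := valP (cover_src pe).
have [|_ e] := @reduce_walk v0 (val g ++ val (cover_src pe)).
  by rewrite walk_cat wg eg.
by rewrite /is_cover_edge e walk_end_cat eg; exact: (valP pe).
Qed.

Definition deck_edge (g : fundamental_group) (pe : cover_edge) : cover_edge :=
  Sub (deck_vertex g (cover_src pe), (val pe).2) (deck_edge_subproof g pe).

Lemma deck_tgt g pe : cover_tgt (deck_edge g pe) = deck_vertex g (cover_tgt pe).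
Proof.
apply: val_inj => /=.
by rewrite -!cats1 reduce_catl reduce_catr catA.
Qed.

(* The path in the universal cover from its base point, the empty walk, to its
   image under g projects to the closed walk g. *)
Definition loop_integral (a : one_form G) (g : fundamental_group) : R :=
  walk_integral (val a) (val g).

Definition is_character (chi : fundamental_group -> R[i]) :=
  (forall g, chi g != 0) /\ (forall g h, chi (g * h)%g = chi g * chi h).

Definition is_unitary_character (chi : fundamental_group -> R[i]) :=
  is_character chi /\ forall g, `|chi g| = 1.

Definition equivariant (chi : fundamental_group -> R[i])
    (h : cgfun universal_cover) :=
  forall g (pe : edge universal_cover) x, x \in `[0, len pe] ->
    h (deck_edge g pe) x = chi g * h pe x.

Definition character_eigenspace (chi : fundamental_group -> R[i]) (l : R[i]) :
    set (cgfun universal_cover) :=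
  [set h | [/\ czero_form h, equivariant chi h &
    forall (pe : edge universal_cover) x, x \in `[0, len pe] ->
      - cderive (cderive h) pe x = l * h pe x]].

(* As a function of chi this is the pi_1-spectrum. *)
Definition character_spectrum (chi : fundamental_group -> R[i]) : spectrum R :=
  fun l => dimension (character_eigenspace chi l).

End FundamentalGroup.

Definition expi (R : realType) (t : R) : R[i] := (cos t +i* sin t)%C.

(* Main.v *)
Require Import Defs.
From mathcomp Require Import all_boot all_order all_algebra finmap.
From mathcomp Require Import all_classical all_reals all_analysis.
From mathcomp Require Import complex ring lra.

(** Write e_a(x) for the exponential of 2 pi i times the integral of the form a
    along the path that leads to the point x of the universal cover from its
    base point.  Since the derivative of e_a is 2 pi i a e_a, multiplication by
    e_a intertwines d + 2 pi i a with d: for h on G with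
    - (d + 2 pi i a)^2 h = l h, the function u = e_a h on the cover satisfies
    - u'' = l u, and it is smooth, continuous at the vertices and satisfies the
    Kirchhoff conditions because the Kirchhoff sums of h' + 2 pi i a h vanish.
    Under a deck transformation g, u is multiplied by the exponential of
    + 2 pi i times the integral of a over g, which is the inverse of the
    character attached to a in the theorem.  The lift used here is therefore the
    complex conjugate of u ([cover_lift]): it has the character of the theorem,
    and the eigenvalue conj(l).  Conversely e_a F is invariant under deck
    transformations when F is equivariant, and its conjugate is the function on
    G whose lift is F ([descend]).  As lifting is conjugate-linear and injective,
    it preserves linear independence, whence
    Spec(G, chi_a)(l) = Spec_a(conj(l)) ([character_spectrum_conj]).

    The conjugation disappears because eigenvalues are real.  For a solution h
    with D = h' + 2 pi i a h, the derivative of the imaginary part of conj(h) D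
    is - Im(l) |h|^2, which has a constant sign, whereas the increments of
    Im(conj(h) D) along the edges add up to zero by the Kirchhoff conditions, G
    being finite ([total_flux]).  If Im(l) is not 0, every increment vanishes,
    and h = 0 ([nonreal_gauge_solution]).

    Both eigenvalue problems are first brought to a common classical form
    ([gauge_solution]), a first order system for the pair (h, D).  On the
    twisted side this is elliptic regularity in dimension one: if h is in W_2
    then h' is the integral of h'', the equation identifies h'' almost
    everywhere with a continuous function, hence h'' exists everywhere and
    equals that function, and differentiating the system again and again shows
    that h is smooth ([bloch_eigenspaceP]).

    As for the correspondence itself, the integral of an exact form over a
    closed walk is 0, and the integral over a walk is unchanged by removing
    backtracking, so a |-> chi_a is well defined on the torus of classes.  It is
    injective because exp(2 pi i t) = 1 only for integral t, and because every
    closed walk is conjugate to one through v0 ([holonomy_eq]).  For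
    surjectivity, a family of walks from v0 to all vertices turns each edge into
    a loop at v0; the class of a form is determined by its integrals over
    the edges, which may be prescribed at will by means of bumps vanishing
    at the end points, and one takes logarithms of the values of the given
    character on the edge loops ([character_holonomy]). *)

Set Implicit Arguments.
Unset Strict Implicit.
Unset Printing Implicit Defensive.

Import Order.TTheory GRing.Theory Num.Theory.
Import numFieldNormedType.Exports.

Local Open Scope classical_set_scope.
Local Open Scope ring_scope.

(** * Derivatives on a closed interval *)

Section RealDerivative.
Context {R : realType}.
Implicit Types (f g : R -> R) (L x l m : R).

(** The derivative as a relation: unlike [derive_on], its rules need no
    differentiability side conditions. *)
Definition has_derive L f x l := diff_quot f x y @[y --> within `[0, L] x^'] --> l.

Lemma has_derive_eq L f g x l : `[0, L]%classic x -> {in `[0, L]%classic, f =1 g} ->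
  has_derive L f x l -> has_derive L g x l.
Proof.
move=> Ax fg; apply: cvg_trans; apply: near_eq_cvg.
by apply: filterS (eq_diff_quot Ax fg) => y ->.
Qed.

Lemma has_derive_lim L f x l : 0 < L -> `[0, L]%classic x -> has_derive L f x l ->
  derivable_on `[0, L] f x /\ derive_on `[0, L] f x = l.
Proof.
move=> L0 Ax fl; have PF := within_itv_proper L0 Ax.
by split; [apply/cvg_ex; exists l|exact: cvg_lim].
Qed.

Lemma derivable_onP L f x : derivable_on `[0, L] f x ->
  has_derive L f x (derive_on `[0, L] f x).
Proof. by []. Qed.

Lemma has_derive_uniq L f x l m : 0 < L -> `[0, L]%classic x ->
  has_derive L f x l -> has_derive L f x m -> l = m.
Proof.
by move=> L0 Ax /(has_derive_lim L0 Ax)[_ <-] /(has_derive_lim L0 Ax)[].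
Qed.

Lemma has_derive_cvg L f x l : has_derive L f x l ->
  f y @[y --> within `[0, L] x^'] --> f x.
Proof.
move=> fl.
have -> : f = (fun y => f x + (y - x) * diff_quot f x y).
  apply/funext => y; rewrite /diff_quot; have [->|yx] := eqVneq y x.
    by rewrite subrr mul0r addr0.
  by rewrite mulrC divfK ?subr_eq0// addrC subrK.
rewrite -[X in _ --> X](_ : f x + (x - x) * l = _); last first.
  by rewrite subrr !mul0r !addr0.
apply: cvgD; first exact: cvg_cst.
apply: cvgM; last exact: fl.
apply: cvgB; last exact: cvg_cst.
by move=> P /= Px; apply: filterS Px => y Py _ _.
Qed.

Lemma has_derive_continuous L f f' : 0 < L ->
  (forall x, `[0, L]%classic x -> has_derive L f x (f' x)) ->
  {within `[0, L], continuous f}.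
Proof.
move=> L0 df; apply: derivable_on_continuous => // x Ax.
exact: (has_derive_lim L0 Ax (df x Ax)).1.
Qed.

Lemma has_derive_cst L c x : has_derive L (cst c) x 0.
Proof.
rewrite /has_derive (_ : diff_quot _ _ = cst 0); first exact: cvg_cst.
by apply/funext => y; rewrite /diff_quot /= subrr mul0r.
Qed.

Lemma has_derive_id L x : has_derive L id x 1.
Proof.
suff H : diff_quot id x y @[y --> x^'] --> (1 : R) by exact: cvg_within_filter H.
apply: (@cvg_trans _ (cst (1 : R) y @[y --> x^'])); last exact: cvg_cst.
apply: near_eq_cvg.
have := nbhs_dnbhs_neq x.
by apply: filterS => y yx /=; rewrite /diff_quot divff// subr_eq0.
Qed.

Lemma has_deriveD L f g x l m : has_derive L f x l -> has_derive L g x m ->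
  has_derive L (fun y => f y + g y) x (l + m).
Proof.
move=> fl gm; rewrite /has_derive.
rewrite (_ : diff_quot _ x = diff_quot f x \+ diff_quot g x); first exact: cvgD.
by apply/funext => y; rewrite /diff_quot /= -mulrDl; congr (_ / _); ring.
Qed.

Lemma has_deriveM L f g x l m : has_derive L f x l -> has_derive L g x m ->
  has_derive L (fun y => f y * g y) x (l * g x + f x * m).
Proof.
move=> fl gm; rewrite /has_derive.
rewrite (_ : diff_quot _ x =
    (fun y => diff_quot f x y * g y + f x * diff_quot g x y)); last first.
  apply/funext => y; rewrite /diff_quot /=; set i := (y - x)^-1; ring.
apply: cvgD; apply: cvgM => //; last exact: cvg_cst.
exact: has_derive_cvg gm.
Qed.

Lemma has_deriveN L f x l : has_derive L f x l ->
  has_derive L (fun y => - f y) x (- l).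
Proof.
move=> fl; rewrite /has_derive (_ : diff_quot _ _ = \- diff_quot f x); first exact: cvgN.
by apply/funext => y; rewrite /diff_quot /= -mulNr; congr (_ / _); ring.
Qed.

Lemma has_deriveB L f g x l m : has_derive L f x l -> has_derive L g x m ->
  has_derive L (fun y => f y - g y) x (l - m).
Proof. by move=> fl gm; apply: has_deriveD => //; exact: has_deriveN. Qed.

(** Passes from the difference quotients at a moving point y to those in the
    increment h, the form used in the definition of [derivable]. *)
Lemma cvg_dnbhs_shift f x l :
  (diff_quot f x y @[y --> x^'] --> l) <->
  ((fun h => h^-1 *: (f (h *: (1 : R^o) + x) - f x)) h @[h --> (0 : R)^'] --> l).
Proof.
split=> /cvgrPdist_lt fl; apply/cvgrPdist_lt => e e0; have := fl e e0;
  move=> /nbhs_ballP[d /= d0 H]; apply/nbhs_ballP; exists d => //=.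
- move=> h /=; rewrite -ball_normE/= sub0r normrN => hd h0.
  have := H (h + x); rewrite /ball/= opprD addrCA subrr addr0 normrN => /(_ hd).
  rewrite -subr_eq0 addrK => /(_ h0); rewrite /diff_quot addrK mulrC.
  by rewrite /GRing.scale/= mulr1.
- move=> y /= hd yx.
  have := H (y - x); rewrite -ball_normE/= sub0r normrN subr_eq0 distrC => /(_ hd yx).
  by rewrite /diff_quot /GRing.scale/= mulr1 subrK mulrC.
Qed.

Lemma is_derive_has_derive L f x l : is_derive x 1 f l -> has_derive L f x l.
Proof.
move=> [fx fl]; have : diff_quot f x y @[y --> x^'] --> l.
  by apply/cvg_dnbhs_shift; rewrite -fl.
exact: cvg_within_filter.
Qed.

Lemma has_derive_is_derive L f x l : x \in `]0, L[ -> has_derive L f x l ->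
  is_derive x 1 f l.
Proof.
rewrite in_itv/= => /andP[x0 xL] fl.
have {}fl : diff_quot f x y @[y --> x^'] --> l.
  move=> U /fl; rewrite !nbhs_simpl /=.
  rewrite -[X in X -> _]/(\forall y \near x^', `[0, L]%classic y -> U (diff_quot f x y)).
  move=> H.
  have : \forall y \near x^', y \in `]0, L[.
    by apply: cvg_within; apply: near_in_itvoo; rewrite in_itv/= x0 xL.
  move: H; apply: filterS2 => y H; rewrite in_itv/= => /andP[y0 yL].
  by apply: H; rewrite /= in_itv/= !ltW.
have {}fl := (cvg_dnbhs_shift f x l).1 fl.
split; first by apply/cvg_ex; exists l.
by apply: cvg_lim fl.
Qed.

End RealDerivative.
Section RealCalculus.
Context {R : realType}.
Implicit Types (f g : R -> R) (L x l m : R).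

(** The usual difficulty, f y = f x for y close to x, is avoided by extending the
    difference quotient of g continuously to its centre. *)
Lemma has_derive_comp L f g x l m : is_derive (f x) 1 g m ->
  has_derive L f x l -> has_derive L (g \o f) x (m * l).
Proof.
move=> [gd gm] fl.
have {gd}gm : diff_quot g (f x) y @[y --> (f x)^'] --> m.
  by apply/cvg_dnbhs_shift; rewrite -gm.
(* Caratheodory's slope function of g at f x *)
pose phi u := if u == f x then m else diff_quot g (f x) u.
have phiE : diff_quot (g \o f) x = (fun y => phi (f y) * diff_quot f x y).
  apply/funext => y; rewrite /phi /diff_quot /=; case: eqVneq => [->|fyx].
    by rewrite !subrr !mul0r mulr0.
  by rewrite mulrA divfK// subr_eq0.
rewrite /has_derive phiE; apply: cvgM => //.
have phic : phi u @[u --> f x] --> m.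
  apply/cvgrPdist_lt => e e0; move/cvgrPdist_lt : gm => /(_ e e0).
  move=> /nbhs_ballP[d d0 H]; apply/nbhs_ballP; exists d => // u ux.
  by rewrite /= /phi; case: eqVneq => [_|uf]; [rewrite subrr normr0|exact: H].
exact: cvg_comp (has_derive_cvg fl) phic.
Qed.

Lemma has_derive_nincr L f f' : 0 < L ->
  (forall x, x \in `[0, L] -> has_derive L f x (f' x)) ->
  (forall x, x \in `[0, L] -> f' x <= 0) ->
  forall x y, 0 <= x -> x <= y -> y <= L -> f y <= f x.
Proof.
move=> L0 df f'0.
have sub x : x \in `]0, L[ -> x \in `[0, L] by apply: subset_itv_oo_cc.
have D x : x \in `]0, L[ -> is_derive x 1 f (f' x).
  by move=> xL; apply: (has_derive_is_derive xL); exact/df/sub.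
apply: ler0_derive1_nincr => [x /D[]//|x xL|].
  by rewrite derive1E; have [_ ->] := D x xL; exact/f'0/sub.
exact: (has_derive_continuous L0 df).
Qed.

Lemma has_derive0_cst L f : 0 < L ->
  (forall x, x \in `[0, L] -> has_derive L f x 0) ->
  forall x, x \in `[0, L] -> f x = f 0.
Proof.
move=> L0 df x; rewrite in_itv/= => /andP[x0 xL].
apply/eqP; rewrite eq_le; apply/andP; split.
  by apply: (has_derive_nincr L0 df).
rewrite -lerN2; apply: (@has_derive_nincr L (fun y => - f y) (fun=> 0)) => // y yL.
by rewrite -oppr0; exact/has_deriveN/df.
Qed.

(** Extending f by its boundary values makes the theorems about functions
    continuous on the whole line applicable at the end points. *)
Lemma continuous_clamp L f : 0 < L -> {within `[0, L], continuous f} ->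
  continuous (fun x => f (Num.max 0 (Num.min x L))).
Proof.
move=> L0 /subspace_continuousP cf x.
have cA y : `[0, L]%classic (Num.max 0 (Num.min y L)).
  by rewrite /= in_itv/= le_max lexx/= ge_max ltW//= ge_min lexx orbT.
have cc : {for x, continuous (fun y : R => Num.max 0 (Num.min y L))}.
  apply: (@continuous_max _ _ (cst 0)); first exact: cvg_cst.
  by apply: (@continuous_min _ _ id (cst L)); [exact: cvg_id|exact: cvg_cst].
apply: (@cvg_comp _ _ _ (fun y => Num.max 0 (Num.min y L)) f _ (within `[0, L] (nbhs (Num.max 0
  (Num.min x L))))); last exact: cf.
move=> P; rewrite /within/= => H.
have : \forall y \near x, `[0, L]%classic (Num.max 0 (Num.min y L)) ->
  P (Num.max 0 (Num.min y L)) := cc _ H.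
rewrite -[X in _ -> X]/(\forall y \near x, P (Num.max 0 (Num.min y L))).
by apply: filterS => y; apply; exact: cA.
Qed.

(** At an end point the derivative of the integral is one-sided; it is obtained
    from the two-sided theorem for the extension of f by constants, integrated
    from -1 so that 0 is an interior point. *)
Lemma FTC1_on L f x : 0 < L -> {within `[0, L], continuous f} -> x \in `[0, L] ->
  has_derive L (fun y => \int[lebesgue_measure]_(t in `[0, y]) f t) x (f x).
Proof.
move=> L0 cf xL; pose g y := f (Num.max 0 (Num.min y L)).
have gE y : y \in `[0, L] -> g y = f y.
  by rewrite in_itv/= /g => /andP[y0 yL]; rewrite min_l// max_r.
have cg : continuous g := continuous_clamp L0 cf.
have ig a b : lebesgue_measure.-integrable `[a, b] (EFin \o g).
  apply: continuous_compact_integrable; first exact: segment_compact.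
  by apply: continuous_subspaceT => y; exact: cg.
have /andP[x0 xL'] : 0 <= x <= L by move: xL; rewrite in_itv.
have xL1 : x < L + 1 by lra.
have N1x : -1 < x by lra.
have [dF F'] := continuous_FTC1_closed xL1 (ig _ _) N1x (cg x).
set F := (F in derivable F) in dF F'.
have : has_derive L (fun y => F y - F 0) x (g x - 0).
  apply: has_deriveB; last exact: has_derive_cst.
  apply: is_derive_has_derive; split; first exact: dF.
  by rewrite -F' derive1E.
rewrite subr0 (gE x xL); apply: has_derive_eq => // y /set_mem yL.
have /andP[y0 yL'] : 0 <= y <= L by move: yL; rewrite /= in_itv.
rewrite Rintegral_itvB//; last by rewrite bnd_simp.
rewrite Rintegral_itv_obnd_cbnd; last first.
  apply: integrableS (ig 0 y) => //.
  exact: subset_itv_oc_cc.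
apply: eq_Rintegral => t /set_mem/=; rewrite in_itv/= => /andP[t0 ty].
by apply: gE; rewrite in_itv/= t0 (le_trans ty).
Qed.

(** The difference of f and the integral of f' has derivative 0. *)
Lemma FTC2_on L f f' x : 0 < L -> {within `[0, L], continuous f'} ->
  (forall x, x \in `[0, L] -> has_derive L f x (f' x)) -> x \in `[0, L] ->
  f x = f 0 + \int[lebesgue_measure]_(t in `[0, x]) f' t.
Proof.
move=> L0 cf df xL.
pose F y := \int[lebesgue_measure]_(t in `[0, y]) f' t.
have H : forall y, y \in `[0, L] -> has_derive L (fun y => f y - F y) y 0.
  by move=> y yL; rewrite -(subrr (f' y)); apply: has_deriveB; [exact: df|exact: FTC1_on].
have := has_derive0_cst L0 H xL; rewrite {2}/F set_itv1 Rintegral_set1 subr0.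
by move=> <-; rewrite subrK.
Qed.

End RealCalculus.
(** * Weak derivatives on a closed interval *)

Section WeakDerivative.
Context {R : realType}.
Implicit Types (f g k : R -> R) (L x : R).
Local Notation mu := (@lebesgue_measure R).

(** The square of a continuous function is continuous, hence integrable on the
    compact interval. *)
Lemma continuous_Lfun2 L g : {within `[0, L], continuous g} ->
  (g \_ `[0, L]) \in Lfun mu 2%:E.
Proof.
move=> cg.
have ig h : {within `[0, L], continuous h} -> mu.-integrable `[0, L] (EFin \o h).
  by apply: continuous_compact_integrable; exact: segment_compact.
have /integrableP[mg _] := ig g cg.
have mg' : measurable_fun setT (g \_ `[0, L]).
  by apply/(measurable_restrictT _ _).1 => //; exact/measurable_realfun.measurable_EFinP.
rewrite inE; apply/andP; split; rewrite inE//=.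
rewrite /finite_norm unlock poweR_lty//.
have -> : (\int[mu]_x (`|(EFin \o g \_ `[0%R, L]) x| `^ 2) =
           \int[mu]_(x in `[0%R, L]) ((g x) ^+ 2)%:E)%E.
  rewrite [RHS]integral_mkcond; apply: eq_integral => x _.
  rewrite /= !patchE; case: ifPn => _; last by rewrite normr0 powR0.
  by rewrite powR_mulrn// -normrX ger0_norm// sqr_ge0.
apply: integrable_lty => //; apply: (ig (fun x => g x * g x)).
by move=> x; apply: continuousM; exact: cg.
Qed.

(** By the Cauchy-Schwarz inequality against the indicator of the interval. *)
Lemma Lfun2_integrable L g : (g \_ `[0, L]) \in Lfun mu 2%:E ->
  mu.-integrable `[0, L] (EFin \o g).
Proof.
move=> g2; apply/integrable_mkcond => //; rewrite restrict_EFin.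
apply/Lfun1_integrable.
have c1 : {within `[0, L], continuous (cst (1 : R))} by move=> x; exact: cst_continuous.
rewrite (_ : g \_ `[0, L] = g \_ `[0, L] \* cst (1 : R) \_ `[0, L]).
  exact: Lfun2_mul_Lfun1 g2 (continuous_Lfun2 c1).
apply/funext => x /=; rewrite !patchE.
by case: ifPn; rewrite ?mulr1 ?mulr0.
Qed.

Lemma continuous_W1_on L f g : {within `[0, L], continuous g} ->
  (forall x, x \in `[0, L] -> f x = f 0 + \int[mu]_(t in `[0, x]) g t) ->
  W1_on L f g.
Proof. by move=> cg fE; split => //; exact: continuous_Lfun2. Qed.

Lemma W1_on_continuous L f g : 0 < L -> W1_on L f g -> {within `[0, L], continuous f}.
Proof.
move=> L0 [/Lfun2_integrable ig fE].
have cF := parameterized_integral_continuous (ltW L0) ig.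
apply: (@subspace_eq_continuous _ _ _ (fun x => f 0 + parameterized_integral mu 0 x g)).
  by move=> x /set_mem xL; exact: esym (fE x xL).
by move=> x; apply: cvgD; [exact: cvg_cst|exact: cF].
Qed.

(** Lebesgue's differentiation theorem for the function g extended by 0, whose
    integral from minus infinity to y agrees with the one over [0, y]. *)
Lemma W1_on_has_derive_ae L f g : 0 < L -> W1_on L f g ->
  {ae mu, forall x, x \in `[0, L] -> has_derive L f x (g x)}.
Proof.
move=> L0 [/Lfun2_integrable ig fE].
have igL := integrable_locally_restrict (measurable_itv _) ig.
have /integrable_mkcond := ig; rewrite restrict_EFin => /(_ (measurable_itv _)) igT.
have ig' y : mu.-integrable `]-oo, y] (EFin \o g \_ `[0, L]).
  by apply: integrableS igT.
have := FTC1Ny ig' igL; apply: filterS; first exact: (ae_filter_ringOfSetsType mu).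
move=> x [dF F'] xL.
set F := (F in derivable F) in dF F'.
have FL : has_derive L F x (g x).
  apply: is_derive_has_derive; split; first exact: dF.
  by rewrite -derive1E F' patchE mem_set.
have := has_deriveD (has_derive_cst L (f 0) x) FL; rewrite add0r.
apply: has_derive_eq => // y /set_mem yL /=.
rewrite (fE y yL) /F; congr (_ + _).
rewrite -Rintegral_mkcondr; congr (Rintegral _ _ _); apply/seteqP; split=> t /=.
  by rewrite !in_itv/= => -[ty /andP[t0 _]]; rewrite t0 ty.
move: yL; rewrite /= !in_itv/= => /andP[_ yL] /andP[t0 ty].
by rewrite ty t0 (le_trans ty yL).
Qed.

(** The regularity principle: a weak derivative that agrees almost everywhere
    with a continuous function can be replaced by it under the integral, and is
    then a derivative at every point. *)
Lemma W1_on_has_derive L f g k : 0 < L -> W1_on L f g ->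
  {within `[0, L], continuous k} ->
  {ae mu, forall x, x \in `[0, L] -> g x = k x} ->
  forall x, x \in `[0, L] -> has_derive L f x (k x).
Proof.
move=> L0 [/Lfun2_integrable ig fE] ck gk x xL.
have ik : mu.-integrable `[0, L] (EFin \o k).
  by apply: continuous_compact_integrable => //; exact: segment_compact.
have := has_deriveD (has_derive_cst L (f 0) x) (FTC1_on L0 ck xL); rewrite add0r.
apply: has_derive_eq => // y /set_mem yL /=.
rewrite (fE y yL); congr (_ + _); rewrite /Rintegral; congr fine.
have sub : `[0, y] `<=` `[0, L].
  apply: subset_itvl; rewrite bnd_simp.
  by move: yL; rewrite /= in_itv/= => /andP[].
have sI h : mu.-integrable `[0, L] (EFin \o h) -> mu.-integrable `[0, y] (EFin \o h).
  exact: integrableS.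
apply: ae_eq_integral => //.
- by have /integrableP[] := sI _ ik.
- by have /integrableP[] := sI _ ig.
- move: gk; apply: filterS; first exact: (ae_filter_ringOfSetsType mu).
  by move=> t gk ty /=; rewrite gk//; exact: sub.
Qed.

End WeakDerivative.
(** * Complex-valued functions on a closed interval *)

Section ComplexDerivative.
Context {R : realType}.
Implicit Types (h k : R -> R[i]) (f : R -> R) (L x l m : R) (c d z w : R[i]).

Local Notation Re := complex.Re.
Local Notation Im := complex.Im.

Lemma has_derive_congr L f (g : R -> R) x l m : f =1 g -> l = m ->
  has_derive L f x l -> has_derive L g x m.
Proof. by move=> /funext -> ->. Qed.

Lemma complex_eq z w : Re z = Re w -> Im z = Im w -> z = w.
Proof. by case: z w => [a b] [a' b'] /= -> ->. Qed.

Lemma RecD z w : Re (z + w) = Re z + Re w. Proof. by case: z w => [a b] []. Qed.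
Lemma ImcD z w : Im (z + w) = Im z + Im w. Proof. by case: z w => [a b] []. Qed.
Lemma RecN z : Re (- z) = - Re z. Proof. by case: z. Qed.
Lemma ImcN z : Im (- z) = - Im z. Proof. by case: z. Qed.
Lemma RecM z w : Re (z * w) = Re z * Re w - Im z * Im w.
Proof. by case: z w => [a b] []. Qed.
Lemma ImcM z w : Im (z * w) = Re z * Im w + Im z * Re w.
Proof. by case: z w => [a b] [] c d /=. Qed.
Lemma RecC (x : R) : Re x%:C%C = x. Proof. by []. Qed.
Lemma ImcC (x : R) : Im x%:C%C = 0. Proof. by []. Qed.
Lemma Rec_conj z : Re (conjc z) = Re z. Proof. by case: z. Qed.
Lemma Imc_conj z : Im (conjc z) = - Im z. Proof. by case: z. Qed.
Lemma Rec_i : Re 'i%C = 0 :> R. Proof. by []. Qed.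
Lemma Imc_i : Im 'i%C = 1 :> R. Proof. by []. Qed.
Lemma Rec_expi (t : R) : Re (expi t) = cos t. Proof. by []. Qed.
Lemma Imc_expi (t : R) : Im (expi t) = sin t. Proof. by []. Qed.
Definition ReIm := (Rec_i, Imc_i, Rec_expi, Imc_expi, RecD, ImcD, RecN, ImcN,
  RecM, ImcM, RecC, ImcC, Rec_conj, Imc_conj).

Lemma conjc_mul (z w : R[i]) : conjc (z * w) = conjc z * conjc w.
Proof. by rewrite rmorphM. Qed.

Lemma conjc_add (z w : R[i]) : conjc (z + w) = conjc z + conjc w.
Proof. by rewrite rmorphD. Qed.

Lemma conjc_opp (z : R[i]) : conjc (- z) = - conjc z.
Proof. by rewrite rmorphN. Qed.

Definition has_cderive L h x c :=
  has_derive L (fun y => Re (h y)) x (Re c) /\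
  has_derive L (fun y => Im (h y)) x (Im c).

Lemma has_cderive_eq L h k x c : `[0, L]%classic x -> {in `[0, L]%classic, h =1 k} ->
  has_cderive L h x c -> has_cderive L k x c.
Proof.
move=> Ax hk [hr hi].
by split; [apply: has_derive_eq hr|apply: has_derive_eq hi] => // y yA; rewrite hk.
Qed.

Lemma has_cderive_uniq L h x c d : 0 < L -> `[0, L]%classic x ->
  has_cderive L h x c -> has_cderive L h x d -> c = d.
Proof.
move=> L0 Ax [hr hi] [hr' hi'].
by apply: complex_eq; [exact: has_derive_uniq hr hr'|exact: has_derive_uniq hi hi'].
Qed.

Lemma has_cderive_cst L c x : has_cderive L (cst c) x 0.
Proof. by split; exact: has_derive_cst. Qed.

Lemma has_cderive_real L f x l : has_derive L f x l ->
  has_cderive L (fun y => (f y)%:C%C) x l%:C%C.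
Proof. by split => //; exact: has_derive_cst. Qed.

Lemma has_cderiveD L h k x c d : has_cderive L h x c -> has_cderive L k x d ->
  has_cderive L (fun y => h y + k y) x (c + d).
Proof.
move=> [hr hi] [kr ki]; split; rewrite ReIm.
  by apply: (has_derive_congr _ erefl (has_deriveD hr kr)) => y; rewrite RecD.
by apply: (has_derive_congr _ erefl (has_deriveD hi ki)) => y; rewrite ImcD.
Qed.

Lemma has_cderiveM L h k x c d : has_cderive L h x c -> has_cderive L k x d ->
  has_cderive L (fun y => h y * k y) x (c * k x + h x * d).
Proof.
move=> [hr hi] [kr ki]; split; rewrite !ReIm.
  apply: (has_derive_congr _ _ (has_deriveB (has_deriveM hr kr) (has_deriveM hi ki))).
    by move=> y; rewrite RecM.
  by ring.
apply: (has_derive_congr _ _ (has_deriveD (has_deriveM hr ki) (has_deriveM hi kr))).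
  by move=> y; rewrite ImcM.
by ring.
Qed.

Lemma has_cderive_conj L h x c : has_cderive L h x c ->
  has_cderive L (fun y => conjc (h y)) x (conjc c).
Proof.
move=> [hr hi]; split; rewrite !ReIm.
  by apply: (has_derive_congr _ erefl hr) => y; rewrite Rec_conj.
by apply: (has_derive_congr _ erefl (has_deriveN hi)) => y; rewrite Imc_conj.
Qed.

Lemma has_cderive_expi L f x l : has_derive L f x l ->
  has_cderive L (fun y => expi (f y)) x (l%:C%C * 'i%C * expi (f x)).
Proof.
move=> fl; split; rewrite !ReIm.
  by apply: (has_derive_congr _ _ (has_derive_comp (is_derive_cos (f x)) fl)) => //; ring.
by apply: (has_derive_congr _ _ (has_derive_comp (is_derive_sin (f x)) fl)) => //; ring.
Qed.

Lemma expiD (s t : R) : expi (s + t) = expi s * expi t.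
Proof. by apply: complex_eq; rewrite !ReIm ?cosD ?sinD; ring. Qed.

Lemma expiN (s : R) : expi (- s) = conjc (expi s).
Proof. by rewrite /expi cosN sinN. Qed.

Lemma expi0 : expi 0 = 1 :> R[i].
Proof. by rewrite /expi cos0 sin0. Qed.

Lemma expi_conjK (s : R) : expi s * conjc (expi s) = 1.
Proof. by rewrite -expiN -expiD subrr expi0. Qed.

Definition csmooth L h :=
  smooth_on `[0, L] (fun x => Re (h x)) /\ smooth_on `[0, L] (fun x => Im (h x)).

(** Smoothness by coinduction: a class of functions closed under
    differentiation consists of smooth functions.  In this way a differential
    equation or a closure property gives all derivatives at once. *)
Lemma csmooth_coind (P : (R -> R[i]) -> Prop) L : 0 < L ->
  (forall h, P h ->
     exists2 h', P h' & forall x, `[0, L]%classic x -> has_cderive L h x (h' x)) ->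
  forall h, P h -> csmooth L h.
Proof.
move=> L0 HP h Ph.
suff H n : exists2 k, P k &
    {in `[0, L]%classic, (fun x => Re (k x)) =1 iter n (derive_on `[0, L])
      (fun x => Re (h x))} /\
    {in `[0, L]%classic, (fun x => Im (k x)) =1 iter n (derive_on `[0, L]) (fun x => Im (h x))}.
  split=> n x Ax; have [k /HP[k' _ /(_ x Ax)[kr ki]] [Er Ei]] := H n.
    exact: (has_derive_lim L0 Ax (has_derive_eq Ax Er kr)).1.
  exact: (has_derive_lim L0 Ax (has_derive_eq Ax Ei ki)).1.
elim: n => [|n [k Pk [Er Ei]]]; first by exists h.
have [k' Pk' kk'] := HP _ Pk; exists k' => //.
split=> x /set_mem Ax; have [kr ki] := kk' x Ax; rewrite iterS.
  by rewrite (has_derive_lim L0 Ax (has_derive_eq Ax Er kr)).2.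
by rewrite (has_derive_lim L0 Ax (has_derive_eq Ax Ei ki)).2.
Qed.

Lemma csmooth_derive L h : csmooth L h ->
  exists2 h', csmooth L h' & forall x, `[0, L]%classic x -> has_cderive L h x (h' x).
Proof.
move=> [hr hi].
exists (fun x => (derive_on `[0, L] (fun x => Re (h x)) x +i*
                  derive_on `[0, L] (fun x => Im (h x)) x)%C).
  by split=> n x Ax; [have := hr n.+1 x Ax|have := hi n.+1 x Ax]; rewrite iterSr.
by move=> x Ax; split; apply: derivable_onP; [exact: hr 0%N x Ax|exact: hi 0%N x Ax].
Qed.

Lemma smooth_csmooth L f : 0 < L -> smooth_on `[0, L] f -> csmooth L (fun x => (f x)%:C%C).
Proof. by move=> L0 sf; split => //; exact: smooth_on0. Qed.

Lemma csmooth_cst L c : 0 < L -> csmooth L (cst c).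
Proof.
move=> L0; apply: (@csmooth_coind (fun h => exists d, h = cst d) L) => //; last by exists c.
move=> _ [d ->]; exists (cst 0); first by exists 0.
by move=> x _; exact: has_cderive_cst.
Qed.

(** The closure of the smooth functions under the operations that occur in gauge
    transformations.  It is closed under differentiation, so that
    [csmooth_coind] applies, without a Leibniz formula of higher order. *)
Inductive smooth_expr L : (R -> R[i]) -> Prop :=
| SmoothLeaf h : csmooth L h -> smooth_expr L h
| SmoothAdd h k : smooth_expr L h -> smooth_expr L k -> smooth_expr L (fun x => h x + k x)
| SmoothMul h k : smooth_expr L h -> smooth_expr L k -> smooth_expr L (fun x => h x * k x)
| SmoothConj h : smooth_expr L h -> smooth_expr L (fun x => conjc (h x))
| SmoothExpi f : smooth_on `[0, L] f -> smooth_expr L (fun x => expi (f x)).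

Lemma smooth_expr_csmooth L h : 0 < L -> smooth_expr L h -> csmooth L h.
Proof.
move=> L0; apply: csmooth_coind => // {}h; elim=> {h}.
- by move=> h /csmooth_derive[h' sh' hh']; exists h' => //; exact: SmoothLeaf.
- move=> h k _ [h' sh' hh'] _ [k' sk' kk'].
  exists (fun x => h' x + k' x); first exact: SmoothAdd.
  by move=> x Ax; apply: has_cderiveD; [exact: hh'|exact: kk'].
- move=> h k sh [h' sh' hh'] sk [k' sk' kk'].
  exists (fun x => h' x * k x + h x * k' x).
    by apply: SmoothAdd; apply: SmoothMul.
  by move=> x Ax; apply: has_cderiveM; [exact: hh'|exact: kk'].
- move=> h sh [h' sh' hh']; exists (fun x => conjc (h' x)); first exact: SmoothConj.
  by move=> x Ax; apply: has_cderive_conj; exact: hh'.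
- move=> f sf; exists (fun x => (derive_on `[0, L] f x)%:C%C * 'i%C * expi (f x)).
    apply: SmoothMul; last exact: SmoothExpi.
    apply: SmoothMul; apply: SmoothLeaf; last exact: csmooth_cst.
    by apply: smooth_csmooth => // n x Ax; rewrite -iterSr; exact: sf n.+1 x Ax.
  move=> x Ax; apply: has_cderive_expi; apply: derivable_onP; exact: sf 0%N x Ax.
Qed.

Lemma csmoothD L h k : 0 < L -> csmooth L h -> csmooth L k ->
  csmooth L (fun x => h x + k x).
Proof.
by move=> L0 sh sk; apply: smooth_expr_csmooth => //; apply: SmoothAdd; exact: SmoothLeaf.
Qed.

Lemma csmoothM L h k : 0 < L -> csmooth L h -> csmooth L k ->
  csmooth L (fun x => h x * k x).
Proof.
by move=> L0 sh sk; apply: smooth_expr_csmooth => //; apply: SmoothMul; exact: SmoothLeaf.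
Qed.

Lemma smooth_on_continuous L f : 0 < L -> smooth_on `[0, L] f ->
  {within `[0, L], continuous f}.
Proof. by move=> L0 sf; apply: derivable_on_continuous => // x; exact: sf 0%N x. Qed.

(** The primitive f joined to the smooth functions is a class closed under
    differentiation. *)
Lemma primitive_smooth L f g : 0 < L -> smooth_on `[0, L] g ->
  (forall x, `[0, L]%classic x -> has_derive L f x (g x)) -> smooth_on `[0, L] f.
Proof.
move=> L0 sg fg.
have [] // : csmooth L (fun x => (f x)%:C%C).
(* f occurs as the complex function with real part f and imaginary part 0 *)
apply: (@csmooth_coind (fun h => csmooth L h \/ h = (fun x => (f x)%:C%C)) L) => //;
  last by right.
move=> h [/csmooth_derive[h' sh' hh']|->]; first by exists h' => //; left.
exists (fun x => (g x)%:C%C); first by left; exact: smooth_csmooth.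
by move=> x Ax; apply: has_cderive_real; exact: fg.
Qed.

End ComplexDerivative.
Section ComplexContinuity.
Context {R : realType}.
Implicit Types (h k : R -> R[i]) (L : R).

Local Notation Re := complex.Re.
Local Notation Im := complex.Im.

Definition ccontinuous L (h : R -> R[i]) :=
  {within `[0, L], continuous (fun x => Re (h x))} /\
  {within `[0, L], continuous (fun x => Im (h x))}.

Lemma ccontinuousD L h k : ccontinuous L h -> ccontinuous L k ->
  ccontinuous L (fun x => h x + k x).
Proof.
move=> [hr hi] [kr ki]; split.
  rewrite (_ : (fun x => Re (h x + k x)) = (fun x => Re (h x) + Re (k x)));
    last by apply/funext => x; rewrite RecD.
  by move=> x; apply: cvgD; [exact: hr|exact: kr].
rewrite (_ : (fun x => Im (h x + k x)) = (fun x => Im (h x) + Im (k x)));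
  last by apply/funext => x; rewrite ImcD.
by move=> x; apply: cvgD; [exact: hi|exact: ki].
Qed.

Lemma ccontinuousM L h k : ccontinuous L h -> ccontinuous L k ->
  ccontinuous L (fun x => h x * k x).
Proof.
move=> [hr hi] [kr ki]; split.
  rewrite (_ : (fun x => Re (h x * k x)) =
    (fun x => Re (h x) * Re (k x) - Im (h x) * Im (k x))); last by apply/funext => x;
      rewrite RecM.
  move=> x; apply: cvgB; apply: cvgM;
  by [exact: hr|exact: kr|exact: hi|exact: ki].
rewrite (_ : (fun x => Im (h x * k x)) = (fun x => Re (h x) * Im (k x) + Im (h x) * Re (k x)));
  last by apply/funext => x; rewrite ImcM.
move=> x; apply: cvgD; apply: cvgM;
by [exact: hr|exact: kr|exact: hi|exact: ki].
Qed.

Lemma has_cderive_continuous L h h' : 0 < L ->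
  (forall x, `[0, L]%classic x -> has_cderive L h x (h' x)) -> ccontinuous L h.
Proof.
by move=> L0 hh'; split;
  [apply: (has_derive_continuous L0 (f' := fun x => Re (h' x)))
  |apply: (has_derive_continuous L0 (f' := fun x => Im (h' x)))] => x /hh'[].
Qed.

Lemma csmooth_continuous L h : 0 < L -> csmooth L h -> ccontinuous L h.
Proof. by move=> L0 [hr hi]; split; exact: smooth_on_continuous. Qed.

End ComplexContinuity.


Lemma fsum_morph (I : choiceType) (U V : zmodType) (phi : U -> V) (A : set I) (F : I -> U) :
  {morph phi : x y / x + y} -> phi 0 = 0 -> finite_set A ->
  phi (\sum_(i \in A) F i) = \sum_(i \in A) phi (F i).
Proof.
by move=> phiD phi0 fA; rewrite !fsbig_finite// (big_morph phi phiD phi0).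
Qed.

(** * The covariant eigenvalue equation as a first order system *)

Section CovariantEquation.
Context {R : realType} (G : metricGraph R).
Implicit Types (a f : gfun G) (h D : cgfun G) (e : edge G) (v : vertex G).

Local Notation Re := complex.Re.
Local Notation Im := complex.Im.

(** The zeroth order term of d + 2 pi i a. *)
Definition twist a e x : R[i] := (2 * pi * a e x)%:C%C * 'i%C.

Lemma conjc_twist a e x :
  conjc (twist a e x) = - twist a e x.
Proof.
rewrite /twist conjc_mul conjc_real -mulrN; congr (_ * _).
by apply: complex_eq; rewrite //= oppr0.
Qed.

(** The classical form of the eigenvalue equation for - (d + 2 pi i a)^2, with D
    playing the part of (d + 2 pi i a) h.  The Kirchhoff condition is put on D:
    for continuous h this amounts to the one on h' ([kirchhoff_gauge]), and it is
    the form that gauge transformations preserve.  With a = 0 it is the equation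
    of the standard Laplacian. *)
Record gauge_solution a (l : R[i]) h D : Prop := GaugeSolution {
  gauge_derive : forall e x, x \in `[0, len e] ->
    has_cderive (len e) (h e) x (D e x - twist a e x * h e x);
  gauge_derive2 : forall e x, x \in `[0, len e] ->
    has_cderive (len e) (D e) x (- (l * h e x) - twist a e x * D e x);
  gauge_vertex : forall d d', dsrc d = dsrc d' ->
    h d.1 (endpoint d) = h d'.1 (endpoint d');
  gauge_kirchhoff : forall v,
    \sum_(d \in star v) (normal d)%:C%C * D d.1 (endpoint d) = 0 :> R[i] }.

Lemma cderiveE h e x c : x \in `[0, len e] -> has_cderive (len e) (h e) x c ->
  cderive h e x = c.
Proof.
move=> xe [hr hi]; apply: complex_eq => /=.
  exact: (has_derive_lim (len_gt0 e) xe hr).2.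
exact: (has_derive_lim (len_gt0 e) xe hi).2.
Qed.

Lemma twist_csmooth a e : is_one_form a -> csmooth (len e) (twist a e).
Proof.
move=> [sa _]; apply: csmoothM (len_gt0 e) _ (csmooth_cst _ (len_gt0 e)).
have -> : (fun x => (2 * pi * a e x)%:C%C) = (fun x => (2 * pi)%:C%C * (a e x)%:C%C).
  by apply/funext => x; rewrite -rmorphM.
apply: csmoothM (len_gt0 e) (csmooth_cst _ (len_gt0 e)) _.
exact: smooth_csmooth (len_gt0 e) (sa e).
Qed.

(** At a vertex, h takes one value only, which factors out of the Kirchhoff sum
    of a. *)
Lemma twist_kirchhoff a h v : is_one_form a ->
  (forall d d', dsrc d = dsrc d' -> h d.1 (endpoint d) = h d'.1 (endpoint d')) ->
  \sum_(d \in star v) (normal d)%:C%C * (twist a d.1 (endpoint d) * h d.1 (endpoint d)) = 0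
    :> R[i].
Proof.
move=> [_ ka] hv; have [[d0 d0v]|Nv] := pselect (exists d, star v d); last first.
  by rewrite fsbig1// => d dv; case: Nv; exists d.
rewrite (eq_fsbigr (fun d => ((2 * pi)%:C%C * 'i%C * h d0.1 (endpoint d0)) *
    (normal d * a d.1 (endpoint d))%:C%C)); last first.
  move=> d /set_mem dv; rewrite (hv d d0) ?dv ?d0v// /twist !rmorphM /=.
  by set z := h _ _; ring.
rewrite -mulr_fsumr -(@fsum_morph _ _ _ (fun x : R => x%:C%C)) ?ka ?mulr0 //.
- by move=> x y; rewrite rmorphD.
- exact: star_finite.
Qed.

Lemma kirchhoff_gauge a h D : is_one_form a ->
  (forall d d', dsrc d = dsrc d' -> h d.1 (endpoint d) = h d'.1 (endpoint d')) ->
  (forall e x, x \in `[0, len e] -> cderive h e x = D e x - twist a e x * h e x) ->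
  (kirchhoff (re_part h) /\ kirchhoff (im_part h)) <->
  forall v, \sum_(d \in star v) (normal d)%:C%C * D d.1 (endpoint d) = 0 :> R[i].
Proof.
move=> oa hv hD.
have E v : \sum_(d \in star v) (normal d)%:C%C * D d.1 (endpoint d) =
           \sum_(d \in star v) (normal d)%:C%C * cderive h d.1 (endpoint d).
  rewrite (eq_fsbigr (fun d => (normal d)%:C%C * cderive h d.1 (endpoint d) +
     (normal d)%:C%C * (twist a d.1 (endpoint d) * h d.1 (endpoint d)))); last first.
    by move=> d _; rewrite hD ?endpoint_in// -mulrDr subrK.
  rewrite fsbig_split/=; last exact: star_finite.
  by rewrite (twist_kirchhoff v oa hv) addr0.
have Er v : Re (\sum_(d \in star v) (normal d)%:C%C * D d.1 (endpoint d)) =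
    \sum_(d \in star v) normal d * ederive (re_part h) d.1 (endpoint d).
  rewrite E (@fsum_morph _ _ _ (@complex.Re R))//; [|exact: RecD|exact: star_finite].
  by apply: eq_fsbigr => d _; rewrite !ReIm mul0r subr0.
have Ei v : Im (\sum_(d \in star v) (normal d)%:C%C * D d.1 (endpoint d)) =
    \sum_(d \in star v) normal d * ederive (im_part h) d.1 (endpoint d).
  rewrite E (@fsum_morph _ _ _ (@complex.Im R))//; [|exact: ImcD|exact: star_finite].
  by apply: eq_fsbigr => d _; rewrite !ReIm mul0r addr0.
split=> [[kr ki] v|k]; first by apply: complex_eq; rewrite ?Er ?Ei.
by split=> v; [rewrite -Er k|rewrite -Ei k].
Qed.

(** The combinations of h and D with smooth coefficients form a class that the
    system closes under differentiation. *)
Lemma gauge_solution_csmooth a l h D e : is_one_form a -> gauge_solution a l h D ->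
  csmooth (len e) (h e).
Proof.
move=> oa s; have L0 := len_gt0 e.
pose P (k : R -> R[i]) := exists (u w : R -> R[i]), [/\ csmooth (len e) u, csmooth (len e) w &
  k = fun x => u x * h e x + w x * D e x].
apply: (@csmooth_coind _ P (len e)) => //; last first.
  exists (cst 1), (cst 0); split; [exact: csmooth_cst|exact: csmooth_cst|].
  by apply/funext => x; rewrite mul1r mul0r addr0.
move=> _ [u [w [su sw ->]]].
have [u' su' uu'] := csmooth_derive su; have [w' sw' ww'] := csmooth_derive sw.
have st := twist_csmooth e oa.
have sN (k : R -> R[i]) : csmooth (len e) k -> csmooth (len e) (fun x => cst (- 1) x * k x).
  by move=> sk; apply: csmoothM => //; exact: csmooth_cst.
exists (fun x => u' x * h e x + u x * (D e x - twist a e x * h e x) +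
    (w' x * D e x + w x * (- (l * h e x) - twist a e x * D e x))); last first.
  move=> x Ax; apply: has_cderiveD; apply: has_cderiveM.
  - exact: uu'.
  - exact: (gauge_derive s).
  - exact: ww'.
  - exact: (gauge_derive2 s).
exists (fun x => u' x + (cst (- 1) x * (u x * twist a e x) + cst (- l) x * w x)).
exists (fun x => u x + (w' x + cst (- 1) x * (w x * twist a e x))).
split.
- exact: csmoothD L0 su' (csmoothD L0 (sN _ (csmoothM L0 su st))
    (csmoothM L0 (csmooth_cst _ L0) sw)).
- exact: csmoothD L0 su (csmoothD L0 sw' (sN _ (csmoothM L0 sw st))).
- by apply/funext => x; rewrite /cst; ring.
Qed.

Lemma gauge_solution_zero_form a l h D : is_one_form a -> gauge_solution a l h D ->
  czero_form h.
Proof.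
move=> oa s.
have [|kr ki] := (kirchhoff_gauge oa (gauge_vertex s) _).2 (gauge_kirchhoff s).
  by move=> e x xe; apply: cderiveE => //; exact: (gauge_derive s).
have sh e := gauge_solution_csmooth e oa s.
by split; split=> //; try (by move=> e; have [] := sh e);
  split=> [e|d d' dd']; rewrite ?/re_part ?/im_part ?(gauge_vertex s dd')//;
  have [] := csmooth_continuous (len_gt0 e) (sh e).
Qed.

Lemma zero_form_W2_domain f : zero_form f -> W2_domain f.
Proof.
move=> [cf sf kf]; split=> // e.
have L0 := len_gt0 e; pose A := `[0, len e]%classic.
have W1 n : W1_on (len e) (iter n (derive_on A) (f e)) (iter n.+1 (derive_on A) (f e)).
  have c1 : {within A, continuous (iter n.+1 (derive_on A) (f e))}.
    by apply: (derivable_on_continuous L0) => x; exact: sf e n.+1 x.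
  apply: continuous_W1_on => // x xe; apply: (FTC2_on L0 c1 _ xe) => y ye.
  by apply: derivable_onP; exact: sf.
by exists (derive_on A (f e)), (derive_on A (derive_on A (f e))); split; [exact: W1 0%N|
  exact: W1 1%N].
Qed.

Lemma gauge_solution_eigen a l h D e x : gauge_solution a l h D -> x \in `[0, len e] ->
  - covariant_derive a (covariant_derive a h) e x = l * h e x.
Proof.
move=> s xe.
have cE y : y \in `[0, len e] -> covariant_derive a h e y = D e y.
  move=> ye; rewrite /covariant_derive (cderiveE ye (gauge_derive s ye)).
  by rewrite -/(twist a e y) subrK.
have H : has_cderive (len e) (covariant_derive a h e) x (- (l * h e x) - twist a e x * D e x).
  apply: (has_cderive_eq _ _ (gauge_derive2 s xe)) => // y /set_mem ye.
  by rewrite cE.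
by rewrite {1}/covariant_derive (cderiveE xe H) cE// -/(twist a e x) subrK opprK.
Qed.

End CovariantEquation.
(** * Regularity of eigenfunctions *)

Section Eigenspaces.
Context {R : realType} (G : metricGraph R).
Implicit Types (a : one_form G) (l : R[i]) (h D : cgfun G) (e : edge G).

Local Notation Re := complex.Re.
Local Notation Im := complex.Im.

Lemma one_formP a : is_one_form (val a).
Proof. by have /asboolP := valP a. Qed.

Lemma is_one_form0 : is_one_form (0 : gfun G).
Proof. exact: one_formP (0 : one_form G). Qed.

Lemma W1_on_has_cderive L (h1 h2 k : R -> R[i]) : 0 < L ->
  W1_on L (fun x => Re (h1 x)) (fun x => Re (h2 x)) ->
  W1_on L (fun x => Im (h1 x)) (fun x => Im (h2 x)) ->
  ccontinuous L k ->
  {ae lebesgue_measure, forall x, x \in `[0, L] -> h2 x = k x} ->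
  forall x, x \in `[0, L] -> has_cderive L h1 x (k x).
Proof.
move=> L0 wr wi [kr ki] hk x xL; split.
  apply: (@W1_on_has_derive _ L _ _ (fun x => Re (k x)) L0 wr kr) => //.
  move: hk; apply: filterS; first exact: (ae_filter_ringOfSetsType lebesgue_measure).
  by move=> y + yL => ->.
apply: (@W1_on_has_derive _ L _ _ (fun x => Im (k x)) L0 wi ki) => //.
move: hk; apply: filterS; first exact: (ae_filter_ringOfSetsType lebesgue_measure).
by move=> y + yL => ->.
Qed.

(** Expanding the equation at a point where h' is differentiable expresses h''
    through h, h', a and a'; the resulting k is continuous, so that h'' = k holds
    everywhere by [W1_on_has_derive]. *)
Lemma bloch_regularity a l h e : cW2_domain h ->
  {ae lebesgue_measure, forall x, x \in `[0, len e] ->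
    - covariant_derive (val a) (covariant_derive (val a) h) e x = l * h e x} ->
  exists h1 : R -> R[i], forall x, x \in `[0, len e] ->
    has_cderive (len e) (h e) x (h1 x) /\
    has_cderive (len e) (fun y => h1 y + twist (val a) e y * h e y) x
      (- (l * h e x) - twist (val a) e x * (h1 x + twist (val a) e x * h e x)).
Proof.
move=> [[_ /(_ e)[f1 [f2 [wf wf1]]] _] [_ /(_ e)[g1 [g2 [wg wg1]]] _]] eqn.
have L0 := len_gt0 e.
pose h1 x := (f1 x +i* g1 x)%C; pose h2 x := (f2 x +i* g2 x)%C.
have c1 : ccontinuous (len e) h1 by split; [exact: W1_on_continuous L0 wf1|
  exact: W1_on_continuous L0 wg1].
have hh1 x : x \in `[0, len e] -> has_cderive (len e) (h e) x (h1 x).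
  move=> xe; apply: (@W1_on_has_cderive _ (h e) h1 h1) => //.
  by apply: aeW => y _.
have [t' st' tt'] := csmooth_derive (twist_csmooth e (one_formP a)).
have ct := csmooth_continuous L0 (twist_csmooth e (one_formP a)).
have ct' := csmooth_continuous L0 st'.
have ch := has_cderive_continuous L0 hh1.
pose t := twist (val a) e.
pose D x := h1 x + t x * h e x.
(* the equation - (D' + t D) = l h solved for h'', where D' = h'' + t' h + t h' *)
pose k x := cst (- l) x * h e x + (cst (- 1) x * (t x * D x) +
  cst (- 1) x * (t' x * h e x + t x * h1 x)).
have cc c : ccontinuous (len e) (cst c) by apply: csmooth_continuous => //; exact: csmooth_cst.
have ck : ccontinuous (len e) k.
  apply: (ccontinuousD (ccontinuousM (cc _) ch)); apply: ccontinuousD.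
    exact: (ccontinuousM (cc _) (ccontinuousM ct (ccontinuousD c1 (ccontinuousM ct ch)))).
  exact: (ccontinuousM (cc _) (ccontinuousD (ccontinuousM ct' ch) (ccontinuousM ct c1))).
have cE y : y \in `[0, len e] -> covariant_derive (val a) h e y = D y.
  by move=> ye; rewrite /covariant_derive (cderiveE ye (hh1 y ye)).
have h2k : {ae lebesgue_measure, forall x, x \in `[0, len e] -> h2 x = k x}.
  have := W1_on_has_derive_ae L0 wf1; have := W1_on_has_derive_ae L0 wg1.
  move: eqn; apply: filterS3; first exact: (ae_filter_ringOfSetsType lebesgue_measure).
  move=> x ex gx fx xe.
  have h12 : has_cderive (len e) h1 x (h2 x) by split; [exact: fx|exact: gx].
  have DD : has_cderive (len e) (covariant_derive (val a) h e) x
      (h2 x + (t' x * h e x + t x * h1 x)).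
    have := has_cderiveD h12 (has_cderiveM (tt' x xe) (hh1 x xe)).
    by apply: has_cderive_eq => // y /set_mem ye; rewrite cE.
  have := ex xe;
    rewrite {1}/covariant_derive (cderiveE xe DD) cE// -/(twist (val a) e x) -/(t x).
  by move=> E; rewrite /k /cst [- l * _]mulNr -E; ring.
exists h1 => x xe; split; first exact: hh1.
have h1k := @W1_on_has_cderive _ h1 h2 k L0 wf1 wg1 ck h2k x xe.
have := has_cderiveD h1k (has_cderiveM (tt' x xe) (hh1 x xe)).
by congr has_cderive; rewrite /k /D /t /cst; ring.
Qed.

(** Continuity and the Kirchhoff conditions at the vertices are common to both
    sides, so that the regularity on each edge suffices. *)
Lemma bloch_eigenspaceP a l h :
  bloch_eigenspace a l h <-> exists D, gauge_solution (val a) l h D.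
Proof.
split=> [[wh eqn]|[D s]]; last first.
  have [zr zi] := gauge_solution_zero_form (one_formP a) s.
  split; first by split; exact: zero_form_W2_domain.
  move=> e; apply: aeW => x xe; exact: gauge_solution_eigen s xe.
have /choice[h1 H] := fun e => bloch_regularity wh (eqn e).
pose D e x := h1 e x + twist (val a) e x * h e x.
have hv d d' : dsrc d = dsrc d' -> h d.1 (endpoint d) = h d'.1 (endpoint d').
  have [[[_ vr] _ _] [[_ vi] _ _]] := wh.
  by move=> dd'; apply: complex_eq; [exact: vr|exact: vi].
exists D; split=> //.
- by move=> e x xe; rewrite /D addrK; have [] := H e x xe.
- by move=> e x xe; have [] := H e x xe.
- have [[_ _ kr] [_ _ ki]] := wh.
  apply/(kirchhoff_gauge (h := h) (one_formP a)) => // e x xe.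
  by rewrite /D addrK; apply: cderiveE => //; have [] := H e x xe.
Qed.

Lemma twist0 e x : twist (0 : gfun G) e x = 0.
Proof. by rewrite /twist mulr0 mul0r. Qed.

(** The corresponding description for the standard Laplacian, whose
    eigenfunctions are smooth by definition. *)
Lemma standard_eigenspaceP l h :
  (czero_form h /\ forall e x, x \in `[0, len e] ->
     - cderive (cderive h) e x = l * h e x) <->
  exists D, gauge_solution (0 : gfun G) l h D.
Proof.
split=> [[[[[_ vr] sr kr] [[_ vi] si ki]] eqn]|[D s]]; last first.
  split; first exact: gauge_solution_zero_form is_one_form0 s.
  move=> e x xe; rewrite -(gauge_solution_eigen s xe).
  have E k : covariant_derive (0 : gfun G) k = cderive k.
    apply/funext => e'; apply/funext => y.
    by rewrite /covariant_derive -/(twist 0 e' y) twist0 mul0r addr0.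
  by rewrite !E.
have hv d d' : dsrc d = dsrc d' -> h d.1 (endpoint d) = h d'.1 (endpoint d').
  by move=> dd'; apply: complex_eq; [exact: vr|exact: vi].
exists (cderive h); split=> //.
- move=> e x xe; rewrite twist0 mul0r subr0.
  by split; apply: derivable_onP; [exact: sr e 0%N x xe|exact: si e 0%N x xe].
- move=> e x xe; rewrite twist0 mul0r subr0 -eqn// opprK.
  by split; apply: derivable_onP; [exact: sr e 1%N x xe|exact: si e 1%N x xe].
- apply/(kirchhoff_gauge (h := h) is_one_form0) => // e x xe.
  by rewrite twist0 mul0r subr0.
Qed.

End Eigenspaces.
(** * Integrals along walks *)

Section WalkIntegral.
Context {R : realType} (G : metricGraph R).
Implicit Types (a : gfun G) (p q : seq (dart G)) (d : dart G).

Lemma dart_integral_rev a d : dart_integral a (rev_dart d) = - dart_integral a d.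
Proof. by case: d => e []; rewrite /dart_integral/= ?mulN1r ?mul1r ?opprK. Qed.

Lemma walk_integral_cat a p q :
  walk_integral a (p ++ q) = walk_integral a p + walk_integral a q.
Proof. by rewrite /walk_integral big_cat. Qed.

Lemma walk_integral_rev a p : walk_integral a (rev_walk p) = - walk_integral a p.
Proof.
rewrite /walk_integral /rev_walk (perm_big (map rev_dart p)) ?perm_rev//.
by rewrite big_map -sumrN; apply: eq_bigr => d _; rewrite dart_integral_rev.
Qed.

(** A backtracking pair of darts contributes two opposite integrals. *)
Lemma walk_integral_push a d p :
  walk_integral a (push d p) = dart_integral a d + walk_integral a p.
Proof.
rewrite /walk_integral; case: p => [|d' p] /=; first by rewrite big_seq1 big_nil addr0.
case: eqVneq => [->|_]; last by rewrite big_cons.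
by rewrite big_cons dart_integral_rev addrA subrr add0r.
Qed.

Lemma walk_integral_reduce a p : walk_integral a (reduce p) = walk_integral a p.
Proof.
elim: p => // d p IH; rewrite [LHS](_ : _ = walk_integral a (push d (reduce p)))//.
by rewrite walk_integral_push IH {2}/walk_integral big_cons.
Qed.

(** The part of the integral of a that accumulates inside the last edge of a
    path. *)
Definition primitive a (e : edge G) x : R := \int[lebesgue_measure]_(t in `[0, x]) a e t.

Lemma has_derive_primitive a e x : is_one_form a -> x \in `[0, len e] ->
  has_derive (len e) (primitive a e) x (a e x).
Proof.
move=> [sa _]; apply: FTC1_on; first exact: len_gt0.
exact: smooth_on_continuous (len_gt0 e) (sa e).
Qed.

Lemma primitive0 a e : primitive a e 0 = 0.
Proof. by rewrite /primitive set_itv1 Rintegral_set1. Qed.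

End WalkIntegral.

(** * The universal cover and the phase of a form *)

Section Covering.
Context {R : realType} (G : metricGraph R) (v0 : vertex G).
Local Notation cover := (universal_cover v0).
Implicit Types (pe qe : edge cover) (w : vertex cover) (g : fundamental_group v0).

Definition proj_edge pe : edge G := (val (pe : cover_edge v0)).2.
Definition proj_vertex w : vertex G := walk_end v0 (val (w : cover_vertex v0)).
Definition proj_dart (d : dart cover) : dart G := (proj_edge d.1, d.2).

Lemma dsrc_proj_dart (d : dart cover) : dsrc (proj_dart d) = proj_vertex (dsrc d).
Proof.
case: d => pe []; rewrite /dsrc/= /proj_vertex; first by rewrite (eqP (valP pe)).
have /andP[wp _] := valP (cover_src pe).
have [|_ ->] := @reduce_walk _ _ v0 (rcons (val (cover_src pe)) ((val pe).2, true)).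
  by rewrite -cats1 walk_cat wp/= andbT /dsrc/= eq_sym; exact: (valP pe).
by rewrite -cats1 walk_end_cat.
Qed.

(** The covering property at a vertex.  A dart leaving the far end of a lifted
    edge is lifted by walking that edge backwards first. *)
Lemma star_proj_bij w : set_bij (star w) (star (proj_vertex w)) proj_dart.
Proof.
split.
- by move=> d /= <-; exact: dsrc_proj_dart.
- move=> [pe b] [qf c] /set_mem/= Sp /set_mem/= Sq [ef bc].
  congr pair => //; rewrite -{c}bc in Sq; apply: val_inj.
  have ef' : (val (pe : cover_edge v0)).2 = (val (qf : cover_edge v0)).2 := ef.
  suff E : cover_src pe = cover_src qf.
    by rewrite [LHS]surjective_pairing [RHS]surjective_pairing ef'; congr pair.
  case: b Sp Sq => /= Sp Sq; first exact: etrans Sp (esym Sq).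
  apply: val_inj.
  by rewrite -!cover_tgtK ef'; congr (reduce (rcons (val _) _)); exact: etrans Sp (esym Sq).
- move=> [e b]; rewrite /star/= /dsrc/=; case: b => /= ew.
    have H : is_cover_edge (w : cover_vertex v0, e) by rewrite /is_cover_edge/= ew.
    by exists (Sub (w : cover_vertex v0, e) H : cover_edge v0, true).
  have /andP[ww rw] := valP (w : cover_vertex v0).
  have [|wr er] := @reduce_walk _ _ v0 (rcons (val (w : cover_vertex v0)) (e, false)).
    by rewrite -cats1 walk_cat ww/= andbT /dsrc/= ew.
  have cw : cover_walk v0 (reduce (rcons (val (w : cover_vertex v0)) (e, false))).
    by rewrite /cover_walk wr reduce_reduced.
  pose u : cover_vertex v0 := Sub _ cw.
  have H : is_cover_edge (u, e).
    by rewrite /is_cover_edge/= er -cats1 walk_end_cat.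
  exists (Sub (u, e) H : cover_edge v0, false) => //; rewrite /star/= /dsrc/=.
  apply: val_inj => /=.
  by rewrite -!cats1 reduce_catl -catA -reduce_catr/= eqxx cats0 reduce_id.
Qed.

(** Two lifts of an edge start at reduced walks p and q with the same end; the
    loop q p^-1 moves one to the other. *)
Lemma deck_transitive pe qe : proj_edge pe = proj_edge qe ->
  exists g, deck_edge g pe = qe.
Proof.
move=> pq; pose p := val (cover_src pe); pose q := val (cover_src qe).
have /andP[wp rp] := valP (cover_src pe); have /andP[wq rq] := valP (cover_src qe).
have epq : walk_end v0 p = walk_end v0 q.
  by rewrite /p /q (eqP (valP pe)) (eqP (valP qe)); congr src.
have [wr er] := rev_walk_walk wp.
have [|wg eg] := @reduce_walk _ _ v0 (q ++ rev_walk p).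
  by rewrite walk_cat wq -epq wr.
have cg : closed_reduced v0 (reduce (q ++ rev_walk p)).
  by rewrite /closed_reduced wg eg walk_end_cat -epq er eqxx reduce_reduced.
exists (Sub _ cg); apply: val_inj; rewrite [RHS]surjective_pairing; congr pair => //.
apply: val_inj => /=.
by rewrite reduce_catl -catA -reduce_catr reduce_rev_walk cats0 reduce_id.
Qed.

Lemma sum_star_proj w (F : dart G -> R[i]) :
  \sum_(d \in star w) F (proj_dart d) = \sum_(d \in star (proj_vertex w)) F d.
Proof. by rewrite (reindex_fsbig _ _ _ _ (star_proj_bij w)). Qed.

Variable a : one_form G.

(** The value at a point of the lifted edge pe of the exponential of 2 pi i times
    the integral of a from the base point of the cover. *)
Definition phase pe x : R[i] :=
  expi (2 * pi * (walk_integral (val a) (val (cover_src pe)) + primitive (val a)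
    (proj_edge pe) x)).

(** The character chi_a of the theorem. *)
Definition holonomy g : R[i] := expi (- (2 * pi * loop_integral a g)).

Lemma phase_conjK pe x : phase pe x * conjc (phase pe x) = 1.
Proof. exact: expi_conjK. Qed.

(** Only the conjugate of the phase has the character [holonomy], because of the
    sign in the exponent; this dictates the form of [cover_lift]. *)
Lemma phase_deck g pe x : conjc (phase (deck_edge g pe) x) = holonomy g * conjc (phase pe x).
Proof.
rewrite /phase /holonomy -!expiN -expiD; congr expi.
by rewrite walk_integral_reduce walk_integral_cat /loop_integral; ring.
Qed.

(** At the end of an edge the phase depends on the vertex only, and so is
    continuous on the cover. *)
Lemma phase_endpoint (d : dart cover) : phase d.1 (endpoint d) =
  expi (2 * pi * walk_integral (val a) (val (dsrc d : cover_vertex v0))).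
Proof.
rewrite /phase; congr (expi (_ * _)); case: d => pe [] /=.
  by rewrite /endpoint/= primitive0 addr0.
rewrite walk_integral_reduce -cats1 walk_integral_cat; congr (_ + _).
by rewrite /walk_integral big_seq1 /dart_integral mul1r.
Qed.

Lemma has_cderive_phase pe x : x \in `[0, len pe] ->
  has_cderive (len pe) (phase pe) x (twist (val a) (proj_edge pe) x * phase pe x).
Proof.
move=> xe.
have H := has_derive_primitive (one_formP a) (xe : x \in `[0, len (proj_edge pe)]).
have := has_cderive_expi (has_deriveM (has_derive_cst _ (2 * pi) x)
  (has_deriveD (has_derive_cst _ (walk_integral (val a) (val (cover_src pe))) x) H)).
by rewrite mul0r !add0r.
Qed.

End Covering.
(** * Eigenfunctions on the graph and on its universal cover *)

Section Transfer.
Context {R : realType} (G : metricGraph R) (v0 : vertex G).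
Hypothesis connected : forall v w : vertex G, exists p, walk v p && (walk_end v p == w).
Variable a : one_form G.
Local Notation cover := (universal_cover v0).
Implicit Types (l : R[i]) (h D : cgfun G) (F : cgfun cover) (pe : edge cover).

Lemma cover_section : exists s : vertex G -> vertex cover, forall v, proj_vertex (s v) = v.
Proof.
suff /choice[s sK] : forall v, exists w : vertex cover, proj_vertex w = v by exists s.
move=> v.
have [p /andP[wp /eqP ep]] := connected v0 v; have [wr er] := reduce_walk wp.
have cw : cover_walk v0 (reduce p) by rewrite /cover_walk wr reduce_reduced.
by exists (Sub _ cw : cover_vertex v0); rewrite /proj_vertex/= er.
Qed.

Lemma lift_edge_exists (e : edge G) : exists pe : edge cover, proj_edge pe = e.
Proof.
have [s sK] := cover_section.
have H : is_cover_edge (s (src e) : cover_vertex v0, e).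
  by rewrite /is_cover_edge/=; apply/eqP; exact: sK.
by exists (Sub _ H : cover_edge v0).
Qed.

(** The conjugation turns the factor of automorphy of phase * h into the
    character [holonomy a], at the price of conjugating the eigenvalue. *)
Definition cover_lift h : cgfun cover := fun pe x => conjc (phase a pe x * h (proj_edge pe) x).

Lemma lift_equivariant h : equivariant (holonomy a) (cover_lift h).
Proof.
move=> g pe x xe; rewrite /cover_lift !rmorphM /= mulrA; congr (_ * _); exact: phase_deck.
Qed.

(** The phase is a gauge transformation that removes the form: the derivative of
    phase * h is phase * D. *)
Lemma lift_solution l h D : gauge_solution (val a) l h D ->
  gauge_solution (0 : gfun cover) (conjc l) (cover_lift h) (cover_lift D).
Proof.
move=> s; split.
- move=> pe x xe; rewrite twist0 mul0r subr0.
  have := has_cderive_conj (has_cderiveM (has_cderive_phase a xe)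
    (gauge_derive s (xe : x \in `[0, len (proj_edge pe)]))).
  by congr has_cderive; rewrite /cover_lift; congr conjc; ring.
- move=> pe x xe; rewrite twist0 mul0r subr0.
  have := has_cderive_conj (has_cderiveM (has_cderive_phase a xe)
    (gauge_derive2 s (xe : x \in `[0, len (proj_edge pe)]))).
  congr has_cderive; by rewrite /cover_lift -conjc_mul -conjc_opp; congr conjc; ring.
- move=> d d' dd'; rewrite /cover_lift !phase_endpoint dd'; congr (conjc (_ * _)).
  by apply: (gauge_vertex s (d := proj_dart d) (d' := proj_dart d'));
    rewrite !dsrc_proj_dart dd'.
- move=> w.
  pose c := conjc (expi (2 * pi * walk_integral (val a) (val (w : cover_vertex v0)))).
  rewrite (eq_fsbigr (fun d => c * (conjc ((normal (proj_dart d))%:C%C *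
      D (proj_dart d).1 (endpoint (proj_dart d)))))); last first.
    move=> d /set_mem dw; rewrite /cover_lift phase_endpoint (dw : dsrc d = w) !conjc_mul -/c.
    by rewrite conjc_real mulrCA.
  rewrite -mulr_fsumr.
  rewrite (sum_star_proj w (fun d => conjc ((normal d)%:C%C * D d.1 (endpoint d)))).
  rewrite -(@fsum_morph _ _ _ (@conjc R)) ?(gauge_kirchhoff s) ?conjc0 ?mulr0//.
  + by move=> x y; rewrite rmorphD.
  + exact: star_finite.
Qed.

(** Derivatives are unique, and a deck transformation is the identity in the
    coordinates of the edges. *)
Lemma equivariant_derive l F (D : cgfun cover) : equivariant (holonomy a) F ->
  gauge_solution (0 : gfun cover) l F D -> equivariant (holonomy a) D.
Proof.
move=> eF s g pe x xe.
have H1 := gauge_derive s (e := deck_edge g pe) (xe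
  : x \in `[0, @len R cover (deck_edge g pe)]).
have := has_cderiveM (has_cderive_cst (len pe) (holonomy a g) x) (gauge_derive s xe).
rewrite !twist0 !mul0r !subr0 add0r in H1 *.
have {}H1 : has_cderive (len pe)
  (fun y => cst (holonomy a g) y * F pe y) x (D (deck_edge g pe) x).
  by apply: (has_cderive_eq _ _ H1) => // y /set_mem ye; exact: eF.
move=> H2; exact: has_cderive_uniq (len_gt0 pe) _ H1 H2.
Qed.

(** The factors of automorphy of F and of the phase are inverse to each other, so
    that their product is a function on G. *)
Lemma phase_invariant F pe qe x : equivariant (holonomy a) F -> proj_edge pe = proj_edge qe ->
  x \in `[0, len pe] -> phase a pe x * F pe x = phase a qe x * F qe x.
Proof.
move=> eF /deck_transitive[g <-] xe; rewrite eF//.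
have := congr1 (@conjc R) (phase_deck a g pe x); rewrite conjc_mul !conjcK => ->.
have zK : holonomy a g * conjc (holonomy a g) = 1 by exact: expi_conjK.
transitivity ((holonomy a g * conjc (holonomy a g)) * (phase a pe x * F pe x)).
  by rewrite zK mul1r.
ring.
Qed.

(** By [phase_invariant] the conjugate of phase * F may be computed on any lift of
    an edge.  One fixed lift is good for the differential equation; at a vertex
    one uses instead lifts that start at a common vertex of the cover. *)
Lemma descend l F (D : cgfun cover) : equivariant (holonomy a) F -> gauge_solution (0
  : gfun cover) l F D ->
  exists2 h, (exists Dh, gauge_solution (val a) (conjc l) h Dh) &
    forall pe x, x \in `[0, len pe] -> F pe x = cover_lift h pe x.
Proof.
move=> eF s; have eD := equivariant_derive eF s.
have /choice[le leK] := lift_edge_exists.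
pose down (K : cgfun cover) : cgfun G := fun e x => conjc (phase a (le e) x * K (le e) x).
have downE K pe x : equivariant (holonomy a) K -> x \in `[0, len pe] ->
    down K (proj_edge pe) x = conjc (phase a pe x * K pe x).
  move=> eK xe; congr conjc; apply: phase_invariant => //.
  by rewrite -[len _]/(len (proj_edge (le (proj_edge pe)))) leK.
have liftE K pe x : equivariant (holonomy a) K -> x \in `[0, len pe] -> K pe x =
  cover_lift (down K) pe x.
  move=> eK xe; rewrite /cover_lift downE// conjc_mul conjcK mulrA [conjc _ * _]mulrC.
  by rewrite phase_conjK mul1r.
have hE e : len (le e) = len e by rewrite -[len _]/(len (proj_edge (le e))) leK.
exists (down F); last by move=> pe x; exact: liftE.
have [sec secK] := cover_section.
have dartE K w (d : dart cover) : equivariant (holonomy a) K -> dsrc d = w ->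
    down K (proj_dart d).1 (endpoint (proj_dart d)) =
    conjc (expi (2 * pi * walk_integral (val a) (val (w
      : cover_vertex v0))) * K d.1 (endpoint d)).
  by move=> eK dw; rewrite (downE K d.1)// ?phase_endpoint ?dw//; exact: endpoint_in.
exists (down D); split.
- move=> e x xe; rewrite -hE in xe.
  have := has_cderive_conj (has_cderiveM (has_cderive_phase a xe) (gauge_derive s xe)).
  rewrite twist0 mul0r subr0 hE leK; congr has_cderive.
  by rewrite /down conjc_add -mulrA [conjc (twist _ _ _ * _)]conjc_mul conjc_twist !conjc_mul;
    ring.
- move=> e x xe; rewrite -hE in xe.
  have := has_cderive_conj (has_cderiveM (has_cderive_phase a xe) (gauge_derive2 s xe)).
  rewrite twist0 mul0r subr0 hE leK; congr has_cderive.
  by rewrite /down conjc_add -mulrA [conjc (twist _ _ _ * _)]conjc_mul conjc_twist !conjc_mul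
    conjc_opp conjc_mul; ring.
- move=> d d' dd'.
  have [_ _ sj] := star_proj_bij (sec (dsrc d)).
  have [c cw <-] : exists2 c, star (sec (dsrc d)) c & proj_dart c = d.
    by have [|c cw cE] := sj d; [rewrite /star/= secK|exists c].
  have [c' cw' <-] : exists2 c, star (sec (dsrc d)) c & proj_dart c = d'.
    by have [|c' cw' cE] := sj d'; [rewrite /star/= secK|exists c'].
  rewrite (dartE F _ c eF cw) (dartE F _ c' eF cw'); congr (conjc (_ * _)).
  by apply: (gauge_vertex s); rewrite (cw : dsrc c = _) (cw' : dsrc c' = _).
- move=> v; rewrite -(secK v) -sum_star_proj.
  pose z := expi (2 * pi * walk_integral (val a) (val (sec v : cover_vertex v0))).
  rewrite (eq_fsbigr (fun d => conjc z * conjc ((normal d)%:C%C * D d.1 (endpoint d))));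
    last first.
    move=> d /set_mem dw; rewrite (dartE D _ d eD dw) !conjc_mul -/z.
    by rewrite conjc_real mulrCA.
  rewrite -mulr_fsumr -(@fsum_morph _ _ _ (@conjc R)) ?(gauge_kirchhoff s) ?conjc0 ?mulr0//.
  + by move=> x y; rewrite rmorphD.
  + exact: star_finite.
Qed.

End Transfer.
(** * Eigenvalues on a finite graph are real *)

Section SelfAdjoint.
Context {R : realType} (G : metricGraph R).
Hypothesis vertex_fin : finite_set [set: vertex G].
Hypothesis edge_fin : finite_set [set: edge G].

Local Notation Re := complex.Re.
Local Notation Im := complex.Im.

Lemma setT_bool : [set: bool] = [set true] `|` [set false].
Proof. by apply/seteqP; split=> // -[] _; [left|right]. Qed.

Lemma finite_bool : finite_set [set: bool].
Proof. by rewrite setT_bool finite_setU; split; exact: finite_set1. Qed.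

Lemma finite_darts : finite_set [set: dart G].
Proof.
rewrite (_ : [set: dart G] = [set: edge G] `*` [set: bool]);
  first exact: (finite_setX edge_fin finite_bool).
by apply/seteqP; split=> // d _.
Qed.

Lemma sum_darts_edges (F : dart G -> R) :
  \sum_(d \in [set: dart G]) F d = \sum_(e \in [set: edge G]) (F (e, true) + F (e, false)).
Proof.
rewrite (_ : [set: dart G] = [set: edge G] `*` [set: bool]); last first.
  by apply/seteqP; split=> // d _.
have -> : \sum_(d \in [set: edge G] `*` [set: bool]) F d =
          \sum_(d \in [set: edge G] `*` [set: bool]) F (d.1, d.2).
  by apply: eq_fsbigr => -[].
rewrite -(pair_fsbig _ (fun e b => F (e, b)) edge_fin finite_bool).
apply: eq_fsbigr => e _.
rewrite setT_bool fsbigU0 ?fsbig_set1//.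
by move=> b [/= -> ].
Qed.

Lemma sum_darts_vertices (F : dart G -> R) :
  \sum_(d \in [set: dart G]) F d = \sum_(v \in [set: vertex G]) \sum_(d \in star v) F d.
Proof.
under [RHS]eq_fsbigr do rewrite fsbig_mkcond.
rewrite exchange_fsbig//; last exact: finite_darts.
apply: eq_fsbigr => d _; rewrite (fsbigD1 (dsrc d))// fsbig1.
  by rewrite /= addr0 patchE mem_set.
by move=> v [_ /= vd]; rewrite patchE memNset// => dv; apply: vd; rewrite -dv.
Qed.

Variables (a : gfun G) (l : R[i]) (h D : cgfun G).
Hypothesis sol : gauge_solution a l h D.

(* The imaginary part of conj(h) D is a probability current; the factor Im l
   gives its derivative a sign that does not depend on l. *)
Let flux (e : edge G) x := Im l * Im (conjc (h e x) * D e x).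

(** The terms |D|^2 and those with the form a are real or cancel. *)
Lemma has_derive_flux e x : x \in `[0, len e] -> has_derive (len e) (flux e) x
  (- (Im l ^+ 2 * (Re (h e x) ^+ 2 + Im (h e x) ^+ 2))).
Proof.
move=> xe.
have [_] := has_cderiveM (has_cderive_conj (gauge_derive sol xe)) (gauge_derive2 sol xe).
move=> /(has_deriveM (has_derive_cst (len e) (Im l) x)).
rewrite mul0r add0r.
have -> : conjc (D e x - twist a e x * h e x) * D e x +
    conjc (h e x) * (- (l * h e x) - twist a e x * D e x) =
    conjc (D e x) * D e x - l * (conjc (h e x) * h e x).
  rewrite conjc_add conjc_opp [conjc (twist _ _ _ * _)]conjc_mul conjc_twist; ring.
congr has_derive; rewrite !ReIm /cst; ring.
Qed.

(** Collected at a vertex, the boundary terms are the constant conj(h) times the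
    Kirchhoff sum of D. *)
Lemma total_flux : \sum_(e \in [set: edge G]) (flux e 0 - flux e (len e)) = 0.
Proof.
transitivity (\sum_(d \in [set: dart G]) - normal d * flux d.1 (endpoint d)).
  rewrite sum_darts_edges; apply: eq_fsbigr => e _.
  by rewrite /normal /endpoint/= opprK mul1r mulN1r.
rewrite sum_darts_vertices; apply: fsbig1 => v _.
have [[d0 d0v]|Nv] := pselect (exists d, star v d); last first.
  by rewrite fsbig1// => d dv; case: Nv; exists d.
transitivity (\sum_(d \in star v) - Im l * Im (conjc (h d0.1 (endpoint d0)) *
    ((normal d)%:C%C * D d.1 (endpoint d)))).
  apply: eq_fsbigr => d /set_mem dv; rewrite /flux (gauge_vertex sol (d := d) (d' := d0)).
    by rewrite !ReIm; ring.
  by rewrite (dv : dsrc d = v) (d0v : dsrc d0 = v).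
rewrite -(@fsum_morph _ _ _ (fun z => - Im l * Im (conjc (h d0.1 (endpoint d0)) * z))).
- by rewrite (gauge_kirchhoff sol) mulr0 mulr0.
- by move=> x y; rewrite mulrDr ImcD mulrDr.
- by rewrite mulr0 mulr0.
- exact: star_finite.
Qed.

(** No edge can compensate the decrease of the flux along another edge, so the
    flux is constant on every edge, and its derivative - (Im l)^2 |h|^2 is 0. *)
Lemma nonreal_gauge_solution e x : Im l != 0 -> x \in `[0, len e] -> h e x = 0.
Proof.
move=> l0 xe.
have f'0 e' y : y \in `[0, len e'] ->
    - (Im l ^+ 2 * (Re (h e' y) ^+ 2 + Im (h e' y) ^+ 2)) <= 0.
  by move=> _; rewrite oppr_le0 mulr_ge0 ?addr_ge0 ?sqr_ge0.
have decr e' := has_derive_nincr (len_gt0 e') (@has_derive_flux e') (f'0 e').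
have f0 e' : flux e' (len e') <= flux e' 0.
  by apply: (decr e'); rewrite // ltW ?len_gt0.
have E : flux e (len e) = flux e 0.
  apply/esym/eqP; rewrite -subr_eq0; apply/eqP.
  have f0' e' : [set: edge G] e' -> 0 <= flux e' 0 - flux e' (len e') by rewrite subr_ge0.
  exact: (pfsumr_eq0 edge_fin f0' total_flux).
have fE y : y \in `[0, len e] -> flux e y = flux e 0.
  rewrite in_itv/= => /andP[y0 yL]; apply/eqP; rewrite eq_le (decr e)//=.
  by rewrite -E (decr e).
have /eqP : - (Im l ^+ 2 * (Re (h e x) ^+ 2 + Im (h e x) ^+ 2)) = 0.
  apply: (has_derive_uniq (len_gt0 e) xe (has_derive_flux xe)).
  by apply: (has_derive_eq _ _ (has_derive_cst (len e) (flux e 0) x)) => // y /set_mem ye;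
    rewrite fE.
rewrite oppr_eq0 mulf_eq0 sqrf_eq0 (negPf l0)/= paddr_eq0 ?sqr_ge0// !sqrf_eq0.
by move=> /andP[/eqP r0 /eqP i0]; exact: complex_eq.
Qed.

End SelfAdjoint.

(** * Equality of multiplicities *)

Section Dimension.
Context {R : realType}.

Lemma eq_dimension (G H : metricGraph R) (S : set (cgfun G)) (T : set (cgfun H)) :
  (forall n, (exists h : 'I_n -> cgfun G, (forall i, S (h i)) /\ lin_independent h) <->
             (exists h : 'I_n -> cgfun H, (forall i, T (h i)) /\ lin_independent h)) ->
  dimension S = dimension T.
Proof.
move=> ST; congr ereal_sup; congr image; apply/seteqP; split=> n /=.
  by move=> /ST.
by move=> /ST.
Qed.

Lemma dimension_trivial (G : metricGraph R) (S : set (cgfun G)) :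
  (forall h, S h -> forall e x, x \in `[0, len e] -> h e x = 0) -> dimension S = 0%:E.
Proof.
move=> S0; rewrite /dimension.
rewrite (_ : [set n | _] = [set 0%N]); first by rewrite image_set1 ereal_sup1.
apply/seteqP; split=> [n [h [Sh ind]]|n -> /=]; last first.
  by exists (fun _ _ _ => 0); split=> [[]//|c _ []].
case: n h Sh ind => // n h Sh ind.
suff E : forall e x, x \in `[0, len e] -> \sum_(i < n.+1) 1 * h i e x = 0.
  by have /eqP := ind (fun=> 1) E ord0; rewrite oner_eq0.
move=> e x xe.
by apply: big1 => i _; rewrite (S0 _ (Sh i) e x xe) mulr0.
Qed.

Variables (G : metricGraph R) (v0 : vertex G) (a : one_form G).
Hypothesis connected : forall v w : vertex G, exists p, walk v p && (walk_end v p == w).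

(** Lifting conjugates the coefficients of a linear relation and multiplies it
    by a phase, which is nowhere 0; every edge has a lift, so that no relation is
    lost. *)
Lemma lin_independent_lift n (h : 'I_n -> cgfun G) (F : 'I_n -> cgfun (universal_cover v0)) :
  (forall i pe x, x \in `[0, len pe] -> F i pe x = cover_lift a (h i) pe x) ->
  lin_independent h <-> lin_independent F.
Proof.
move=> Fh; have key c (pe : edge (universal_cover v0)) x : x \in `[0, len pe] ->
    \sum_(i < n) c i * F i pe x =
    conjc (phase a pe x * \sum_(i < n) conjc (c i) * h i (proj_edge pe) x).
  move=> xe; rewrite mulr_sumr rmorph_sum /=; apply: eq_bigr => i _.
  by rewrite Fh// /cover_lift !conjc_mul conjcK; ring.
split=> ind c c0 i.
  have /eqP : conjc (c i) = 0.
    apply: (ind (fun i => conjc (c i))) => e x xe.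
    have [pe peE] := lift_edge_exists v0 connected e.
    have xe' : x \in `[0, len pe] by rewrite -[len pe]/(len (proj_edge pe)) peE.
    have := c0 pe x xe'; rewrite key// peE conjc_mul => /eqP.
    rewrite mulf_eq0 !conjc_eq0 => /orP[/eqP p0|/eqP//].
    have := phase_conjK a pe x; rewrite p0 mul0r => /esym/eqP.
    by rewrite oner_eq0.
  by rewrite conjc_eq0 => /eqP.
have /eqP : conjc (c i) = 0.
  apply: (ind (fun i => conjc (c i))) => pe x xe; rewrite key//.
  under eq_bigr do rewrite conjcK.
  by rewrite c0 ?mulr0 ?conjc0.
by rewrite conjc_eq0 => /eqP.
Qed.

End Dimension.
Section Spectra.
Context {R : realType} (G : quantumGraph R) (v0 : vertex G).
Variable a : one_form G.

Lemma character_eigenspaceP l (F : cgfun (universal_cover v0)) :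
  character_eigenspace (holonomy a) l F <->
  equivariant (holonomy a) F /\ exists D, gauge_solution (0 : gfun (universal_cover v0)) l F D.
Proof.
split=> [[zF eF lF]|[eF /standard_eigenspaceP[zF lF]]]; last by split.
by split=> //; apply/standard_eigenspaceP.
Qed.

Lemma character_spectrum_conj l :
  character_spectrum (v0 := v0) (holonomy a) l = form_spectrum a (conjc l).
Proof.
apply: eq_dimension => n; split=> [[F [SF ind]]|[h [Sh ind]]].
  have /choice[h H] : forall i, exists h : cgfun G, bloch_eigenspace a (conjc l) h /\
      forall pe x, x \in `[0, len pe] -> F i pe x = cover_lift a h pe x.
    move=> i; have [eF [D sF]] := (character_eigenspaceP _ _).1 (SF i).
    have [h sh hF] := descend (@qconnected _ G) eF sF.
    by exists h; split=> //; exact/bloch_eigenspaceP.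
  exists h; split; first by move=> i; have [] := H i.
  apply/(lin_independent_lift (@qconnected _ G) (F := F)) => //.
  by move=> i pe x; have [_ HF] := H i; exact: HF.
exists (fun i => cover_lift a (h i)); split; last first.
  by apply/(lin_independent_lift (h := h) (@qconnected _ G)).
move=> i; apply/character_eigenspaceP; split; first exact: lift_equivariant.
have /bloch_eigenspaceP[D sD] := Sh i.
by exists (cover_lift a D); rewrite -[l]conjcK; exact: lift_solution.
Qed.

(** Both sides vanish unless l is real. *)
Lemma form_spectrum_conj l : form_spectrum a (conjc l) = form_spectrum a l.
Proof.
have [l0|l0] := eqVneq (complex.Im l) 0.
  congr (form_spectrum a _); apply: complex_eq; first by rewrite Rec_conj.
  by rewrite Imc_conj l0 oppr0.
have trivial m : complex.Im m != 0 -> form_spectrum a m = 0%E.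
  move=> m0; apply: dimension_trivial => h /bloch_eigenspaceP[D s] e x.
  exact: (nonreal_gauge_solution (@vertex_finite _ G) (@edge_finite _ G) s m0).
by rewrite !trivial// Imc_conj oppr_eq0.
Qed.

Lemma character_form_spectrum : character_spectrum (v0 := v0) (holonomy a) = form_spectrum a.
Proof. by apply/funext => l; rewrite character_spectrum_conj form_spectrum_conj. Qed.

End Spectra.
(** * The exponential on the unit circle *)

Section UnitCircle.
Context {R : realType}.
Implicit Types (t : R) (n : int).

Lemma expi_int n : expi (2 * pi * n%:~R) = 1 :> R[i].
Proof.
have nat_case (m : nat) : expi (2 * pi * m%:R) = 1 :> R[i].
  elim: m => [|m IH]; first by rewrite mulr0 expi0.
  rewrite [X in expi (_ * X)](_ : _ = m%:R + 1); last by rewrite natr1.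
  rewrite mulrDr mulr1 expiD IH mul1r.
  by rewrite /expi mulr_natl cos2pi sin2pi.
case: n => m; first exact: nat_case.
by rewrite NegzE mulrNz mulrN expiN nat_case conjc1.
Qed.

(** Reduced modulo 1, t = r with 0 <= r < 1 and cos(2 pi r) = 1 forces
    sin(pi r) = 0, while the sine is positive inside ]0, pi[. *)
Lemma expi_eq1 t : expi (2 * pi * t) = 1 :> R[i] -> t \is a Num.int.
Proof.
move=> et; have /andP[nt tn] := floor_itv t; set n := Num.floor t in nt tn.
pose r := t - n%:~R.
have r0 : 0 <= r by rewrite subr_ge0.
have r1 : r < 1 by move: tn; rewrite intrD /r; lra.
have er : expi (2 * pi * r) = 1 :> R[i].
  by rewrite mulrBr expiD expiN et expi_int conjc1 mulr1.
have s0 : sin (pi * r) = 0.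
  have : cos ((pi * r) *+ 2) = 1.
    by rewrite -mulr_natl mulrA; case: er.
  rewrite cos_mulr2n => c1; apply/eqP; rewrite -sqrf_eq0 sin2cos2; apply/eqP.
  move: c1; rewrite mulr2n; lra.
have r00 : r = 0.
  apply/eqP; apply: contraT => rn0; have : 0 < sin (pi * r).
    have rp : 0 < r by rewrite lt_def rn0.
    by apply: sin_gt0_pi; rewrite mulr_gt0 ?pi_gt0//= gtr_pMr ?pi_gt0.
  by rewrite s0 ltxx.
by move/eqP: r00; rewrite subr_eq0 => /eqP ->; exact: intr_int.
Qed.

Lemma expi_norm t : `|expi t : R[i]| = 1.
Proof. by rewrite normc_def /= cos2Dsin2 sqrtr1. Qed.

Lemma expi_surj (z : R[i]) : `|z| = 1 -> exists t, z = expi t.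
Proof.
case: z => x y /(congr1 (fun u => u ^+ 2)); rewrite -add_Re2_Im2/= expr1n => -[xy].
have x1 : -1 <= x <= 1.
  by rewrite -ler_norml -(@ler_pXn2r _ 2)// ?nnegrE// expr1n real_normK ?num_real//; have
    := sqr_ge0 y; lra.
have sE : sin (acos x) = `|y|.
  by rewrite sin_acos// (_ : 1 - x ^+ 2 = y ^+ 2) ?sqrtr_sqr//; lra.
have cE : cos (acos x) = x by apply: acosK; rewrite in_itv.
have [y0|y0] := leP 0 y.
  by exists (acos x); rewrite /expi sE cE ger0_norm.
by exists (- acos x); rewrite /expi cosN sinN sE cE ltr0_norm// opprK.
Qed.

End UnitCircle.
Lemma expi_eq (R : realType) (s t : R) :
  expi (- (2 * pi * s)) = expi (- (2 * pi * t)) <-> s - t \is a Num.int.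
Proof.
split=> [st|/intrP[n stn]].
  apply: expi_eq1; have := expi_conjK (2 * pi * s).
  by rewrite -expiN st -expiD => <-; rewrite mulrBr.
rewrite (_ : s = t + n%:~R); last by rewrite -stn addrCA subrr addr0.
by rewrite mulrDr opprD expiD [X in _ * X]expiN expi_int conjc1 mulr1.
Qed.

(** * Classes of forms and their holonomies *)

Section Torus.
Context {R : realType} (G : metricGraph R).
Implicit Types (a b : one_form G) (c : dR_torus G).

(** A continuous function has a value at each vertex; at a vertex without darts
    the value 0 is assigned. *)
Lemma vertex_values (f : gfun G) :
  (forall d d', dsrc d = dsrc d' -> f d.1 (endpoint d) = f d'.1 (endpoint d')) ->
  exists V : vertex G -> R, forall d, f d.1 (endpoint d) = V (dsrc d).
Proof.
move=> fv.
have /choice[V VP] : forall v, exists y, forall d, dsrc d = v -> f d.1 (endpoint d) = y.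
  move=> v; have [[d0 <-]|Nv] := pselect (exists d, dsrc d = v).
    by exists (f d0.1 (endpoint d0)) => d; exact: fv.
  by exists 0 => d dv; case: Nv; exists d.
by exists V => d; exact: VP.
Qed.

(** The integral of df along a walk telescopes to the difference of the values
    of f at its ends. *)
Lemma exact_walk_integral (f a : gfun G) : zero_form f ->
  (forall e x, x \in `[0, len e] -> a e x = ederive f e x) ->
  forall v p, walk v p -> walk_end v p = v -> walk_integral a p = 0.
Proof.
move=> [[_ /vertex_values[V VE]] sf _] af v p wp ep.
suff: walk_integral a p = V (walk_end v p) - V v by rewrite ep subrr.
have int_e e : \int[lebesgue_measure]_(x in `[0, len e]) a e x = V (tgt e) - V (src e).
  have L0 := len_gt0 e.
  have cf' : {within `[0, len e], continuous (ederive f e)}.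
    by apply: (derivable_on_continuous L0) => x; exact: sf e 1%N x.
  have Le : len e \in `[0, len e] by rewrite in_itv/= lexx ltW.
  transitivity (\int[lebesgue_measure]_(x in `[0, len e]) ederive f e x).
    by apply: eq_Rintegral => x /set_mem; exact: af.
  have := FTC2_on L0 cf' (fun x xe => derivable_onP (sf e 0%N x xe)) Le.
  rewrite /= (VE (e, false)) (VE (e, true)) /dsrc/= => ->.
  by rewrite addrAC subrr add0r.
elim: p v {ep} wp => [|d p IH] v /=; first by rewrite /walk_integral big_nil subrr.
move=> /andP[/eqP <- /IH]; rewrite /walk_integral big_cons => ->.
rewrite -[walk_end _ (d :: p)]/(walk_end (dtgt d) p).
have -> : dart_integral a d = V (dtgt d) - V (dsrc d).
  by case: d => e []; rewrite /dart_integral int_e /dsrc /dtgt/= ?mul1r ?mulN1r ?opprB.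
by rewrite addrC addrA subrK.
Qed.

(** Integrality is defined through a representative of the class of a - b; another
    representative differs by an exact form, whose periods are 0. *)
Lemma torus_class_eq a b : torus_class a = torus_class b <->
  forall v p, walk v p -> walk_end v p = v ->
    walk_integral (val a) p - walk_integral (val b) p \is a Num.int.
Proof.
have E : torus_class a = torus_class b <-> dR_class (a - b) \in @H1dR_int _ G.
  rewrite /dR_class raddfB -/(dR_class a) -/(dR_class b) Quotient.idealrBE.
  by split=> /eqP.
split=> [/E/asboolP[c /eqP cab ic] v p wp ep|H]; last first.
  apply/E/asboolP; exists (a - b) => // v p wp ep.
  by rewrite walk_integralB; exact: H wp ep.
have : c - (a - b) \in @exact_pred _ G by rewrite Quotient.idealrBE.
move=> /asboolP[f zf fE]; have := exact_walk_integral zf fE wp ep.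
rewrite walk_integralB walk_integralB => /eqP; rewrite subr_eq0 => /eqP <-.
exact: ic ep.
Qed.

Lemma torus_class_surj c : torus_class (repr (repr c)) = c.
Proof. by rewrite /torus_class /dR_class !reprK. Qed.

(** The fundamental group sees only loops at v0; a closed walk p at another vertex
    is reached by a walk q, and q p q^-1 has the same integral as p. *)
Lemma holonomy_eq (v0 : vertex G) a b :
  (forall v w : vertex G, exists p, walk v p && (walk_end v p == w)) ->
  holonomy (v0 := v0) a = holonomy b <-> torus_class a = torus_class b.
Proof.
move=> connected; split=> [ab|/torus_class_eq ab]; last first.
  apply/funext => g; apply/expi_eq; have /and3P[wg /eqP eg _] := valP g.
  exact: ab wg eg.
apply/torus_class_eq => v p wp ep.
have [q /andP[wq /eqP endq]] := connected v0 v.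
have [wr er] := rev_walk_walk wq.
have [|wl el] := @reduce_walk _ _ v0 (q ++ p ++ rev_walk q).
  by rewrite !walk_cat wq endq wp ep -endq wr.
have cl : closed_reduced v0 (reduce (q ++ p ++ rev_walk q)).
  by rewrite /closed_reduced wl el !walk_end_cat endq ep -endq er eqxx reduce_reduced.
have /expi_eq := congr1 (fun chi => chi (Sub _ cl)) ab.
rewrite /loop_integral /= !walk_integral_reduce !walk_integral_cat !walk_integral_rev.
congr (_ \is a _); ring.
Qed.

End Torus.
(** * Forms with prescribed integrals over the edges *)

Section PrescribedIntegrals.
Context {R : realType} (G : metricGraph R).

(** Vanishing at both ends makes the Kirchhoff condition of a form trivial. *)
Lemma smooth_bump (L c : R) : 0 < L -> smooth_on `[0, L] (fun x => c * (x * (L - x))).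
Proof.
move=> L0; have sid : csmooth L (fun x => x%:C%C).
  apply: smooth_csmooth => //; apply: (primitive_smooth (g := cst 1)) => //.
    exact: (csmooth_cst 1 L0).1.
  by move=> x _; exact: has_derive_id.
have sc d := @csmooth_cst R L d L0.
have [+ _] := csmoothM L0 (sc c%:C%C) (csmoothM L0 sid (csmoothD L0 (sc L%:C%C)
  (csmoothM L0 (sc (-1)) sid))).
congr smooth_on; apply/funext => x; rewrite /cst !ReIm /=; ring.
Qed.

(** The constant 6 is the inverse of the integral of x (1 - x) over [0, 1]. *)
Lemma integral_bump (L c : R) : 0 < L ->
  \int[lebesgue_measure]_(x in `[0, L]) (6 * c / L ^+ 3 * (x * (L - x))) = c.
Proof.
move=> L0.
have LL : L \in `[0, L] by rewrite in_itv/= lexx ltW.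
pose F x := 6 * c / L ^+ 3 * (L / 2 * (x * x) - 3^-1 * (x * (x * x))).
have dF x : x \in `[0, L] -> has_derive L F x (6 * c / L ^+ 3 * (x * (L - x))).
  move=> xL; have dx := has_derive_id L x; have dxx := has_deriveM dx dx.
  have := has_deriveM (has_derive_cst L (6 * c / L ^+ 3) x)
    (has_deriveB (has_deriveM (has_derive_cst L (L / 2) x) dxx)
                 (has_deriveM (has_derive_cst L 3^-1 x) (has_deriveM dx dxx))).
  by congr has_derive; rewrite /cst /=; set k := _ / L ^+ 3; field.
have := FTC2_on L0 (smooth_on_continuous L0 (smooth_bump L0)) dF LL.
rewrite (_ : F 0 = 0) ?add0r => [<-|]; last by rewrite /F !mul0r !mulr0 subrr mulr0.
by rewrite /F; field; rewrite gt_eqF.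
Qed.

Lemma form_with_integrals (theta : edge G -> R) : exists a : one_form G,
  forall d, dart_integral (val a) d = (if d.2 then 1 else -1) * theta d.1.
Proof.
pose f : gfun G := fun e x => 6 * theta e / len e ^+ 3 * (x * (len e - x)).
have fone : f \in @one_form_pred _ G.
  apply/asboolP; split=> [e|v]; first exact: smooth_bump (len_gt0 e).
  apply: fsbig1 => -[e b] _; rewrite /f /endpoint /=.
  by case: b; rewrite ?mul0r ?subrr ?mulr0 ?mul0r ?mulr0.
by exists (Sub f fone) => d; rewrite /dart_integral integral_bump ?len_gt0.
Qed.

End PrescribedIntegrals.

Lemma rev_walk_cat (E : eqType) (p q : seq (E * bool)) :
  rev_walk (p ++ q) = rev_walk q ++ rev_walk p.
Proof. by rewrite /rev_walk map_cat rev_cat. Qed.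

Lemma reduce_cat_rev_walk (E : eqType) (p : seq (E * bool)) :
  reduce (p ++ rev_walk p) = [::].
Proof. by rewrite -{1}[p]rev_walkK reduce_rev_walk. Qed.

Lemma reduce_cancel (E : eqType) (p q r : seq (E * bool)) :
  reduce (p ++ rev_walk q ++ q ++ r) = reduce (p ++ r).
Proof.
by rewrite -reduce_catr [rev_walk q ++ _]catA -(reduce_catl (rev_walk q ++ q)) reduce_rev_walk
  reduce_catr.
Qed.

(** * Every unitary character is a holonomy *)

Section Characters.
Context {R : realType} (G : metricGraph R) (v0 : vertex G).
Hypothesis connected : forall v w : vertex G, exists p, walk v p && (walk_end v p == w).
Local Notation group := (fundamental_group v0).

Lemma holonomy_unitary (a : one_form G) : is_unitary_character (holonomy (v0 := v0) a).
Proof.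
have n1 g : `|holonomy a g| = 1 by exact: expi_norm.
split=> //; split=> [g|g h]; first by rewrite -normr_gt0 n1.
rewrite /holonomy -expiD; congr expi.
by rewrite /loop_integral walk_integral_reduce walk_integral_cat; ring.
Qed.

Variable chi : group -> R[i].
Hypothesis chiU : is_unitary_character chi.

Definition closed_walk p := walk v0 p && (walk_end v0 p == v0).

(** The character as a function of closed walks that need not be reduced.  The
    default value of [insubd] is not reached on closed walks, whose reductions
    are closed reduced walks. *)
Definition chi_walk (p : seq (dart G)) : R[i] := chi (insubd (fg_one v0) (reduce p)).

Lemma closed_walk_reduce p : closed_walk p -> closed_reduced v0 (reduce p).
Proof.
move=> /andP[wp /eqP ep]; have [wr er] := reduce_walk wp.
by rewrite /closed_reduced wr er ep eqxx reduce_reduced.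
Qed.

Lemma chi_walk_group (g : group) : chi_walk (val g) = chi g.
Proof. by rewrite /chi_walk fg_reduce_id valKd. Qed.

Lemma chi_walk_cat p q : closed_walk p -> closed_walk q ->
  chi_walk (p ++ q) = chi_walk p * chi_walk q.
Proof.
move=> cp cq; have [[_ chiM] _] := chiU; rewrite /chi_walk -chiM; congr chi.
have cpq : closed_walk (p ++ q).
  by move: cp cq => /andP[wp /eqP ep] /andP[wq endq];
    rewrite /closed_walk walk_cat walk_end_cat ep wp wq.
apply: val_inj; rewrite -[(_ * _)%g]/(fg_mul _ _) SubK !val_insubd !closed_walk_reduce//.
by rewrite reduce_catl reduce_catr.
Qed.

Lemma chi_walk_reduce p q : reduce p = reduce q -> chi_walk p = chi_walk q.
Proof. by rewrite /chi_walk => ->. Qed.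

Lemma chi_walk_nil : chi_walk [::] = 1.
Proof.
have [[chi0 chiM] _] := chiU.
have -> : chi_walk [::] = chi 1%g by rewrite -chi_walk_group.
by apply: (mulfI (chi0 1%g)); rewrite -chiM mulg1 mulr1.
Qed.

Lemma chi_walk_norm p : `|chi_walk p| = 1.
Proof. by have [_] := chiU; exact. Qed.

Lemma chi_walk_conj p q : closed_walk p -> closed_walk q -> reduce (p ++ q) = [::] ->
  chi_walk q = conjc (chi_walk p).
Proof.
move=> cp cq pq.
have E : chi_walk p * chi_walk q = 1.
  by rewrite -chi_walk_cat// -chi_walk_nil; apply: chi_walk_reduce; rewrite pq.
have [t pt] := expi_surj (chi_walk_norm p).
by rewrite -[RHS]mulr1 -E mulrA pt [conjc _ * _]mulrC expi_conjK mul1r.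
Qed.

(** Walks q v from v0 to all vertices v make any walk p from v to w the loop
    q v, p, (q w)^-1 at v0.  Concatenation of walks becomes multiplication of
    loops, so the character is known on all of them once it is known on the
    edges, where a form with suitable integrals reproduces it.  The walk q v0
    need not be empty, but it only conjugates loops at v0, to which a character
    is blind. *)
Lemma character_holonomy : exists a : one_form G, holonomy (v0 := v0) a = chi.
Proof.
have /choice[q qP] : forall v, exists q, walk v0 q && (walk_end v0 q == v).
  exact: connected.
have wq v : walk v0 (q v) by case/andP: (qP v).
have endq v : walk_end v0 (q v) = v by case/andP: (qP v) => _ /eqP.
pose loop v p := q v ++ p ++ rev_walk (q (walk_end v p)).
have loop_closed v p : walk v p -> closed_walk (loop v p).
  move=> wp; rewrite /closed_walk /loop !walk_cat !walk_end_cat wq endq wp /=.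
  by have [] := rev_walk_walk (wq (walk_end v p)); rewrite endq => -> ->; rewrite eqxx.
have /choice[theta thetaP] : forall e, exists t : R,
    chi_walk (loop (src e) [:: (e, true)]) = expi (- (2 * pi * t)).
  move=> e; have [t tE] := expi_surj (chi_walk_norm (loop (src e) [:: (e, true)])).
  exists (- (t / (2 * pi))); rewrite tE; congr expi.
  by rewrite mulrN opprK mulrC divfK// mulf_neq0 ?pnatr_eq0// gt_eqF ?pi_gt0.
have [a aE] := form_with_integrals theta; exists a.
have loop_cat v p r : walk v p -> walk (walk_end v p) r ->
    chi_walk (loop v (p ++ r)) = chi_walk (loop v p) * chi_walk (loop (walk_end v p) r).
  move=> wp wr; rewrite -chi_walk_cat; [|exact: loop_closed|exact: loop_closed].
  apply: chi_walk_reduce; rewrite /loop walk_end_cat.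
  set u := walk_end v p; set x := rev_walk (q (walk_end u r)).
  by rewrite -!catA [in RHS](catA (q v)) reduce_cancel -catA.
have loop_nil v : chi_walk (loop v [::]) = 1.
  rewrite -chi_walk_nil; apply: chi_walk_reduce.
  by rewrite /loop/= /walk_end/= -{1}[q v]rev_walkK reduce_rev_walk.
have loop_dart d : chi_walk (loop (dsrc d) [:: d]) =
  expi (- (2 * pi * dart_integral (val a) d)).
  case: d => e []; first by rewrite thetaP aE mul1r.
  rewrite aE/= mulN1r mulrN opprK -[RHS]conjcK -expiN -thetaP.
  apply: chi_walk_conj; [by apply: loop_closed; rewrite /= eqxx|by apply: loop_closed;
    rewrite /= eqxx|].
  rewrite -[RHS](reduce_cat_rev_walk (loop (src e) [:: (e, true)])).
  by congr (reduce (_ ++ _)); rewrite /loop !rev_walk_cat rev_walkK catA.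
have loop_walk p v : walk v p ->
    chi_walk (loop v p) = expi (- (2 * pi * walk_integral (val a) p)).
  elim: p v => [|d p IH] v wp;
    first by rewrite loop_nil /walk_integral big_nil mulr0 oppr0 expi0.
  move: wp => /= /andP[/eqP <- wp].
  rewrite -cat1s loop_cat//=; last by rewrite eqxx.
  rewrite loop_dart IH// -expiD; congr expi.
  by rewrite /walk_integral big_cons; ring.
apply/funext => g; have /and3P[wg /eqP eg _] := valP g.
rewrite /holonomy /loop_integral -(loop_walk _ _ wg) -chi_walk_group.
have cq : closed_walk (q v0) by rewrite /closed_walk wq endq eqxx.
have cg : closed_walk (val g) by rewrite /closed_walk wg eg eqxx.
have cr : closed_walk (rev_walk (q v0)).
  by rewrite /closed_walk; have [] := rev_walk_walk (wq v0); rewrite endq => -> ->;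
    rewrite eqxx.
have cgr : closed_walk (val g ++ rev_walk (q v0)).
  by move: cg cr; rewrite /closed_walk walk_cat walk_end_cat eg => /andP[-> _].
rewrite /loop eg !chi_walk_cat// (chi_walk_conj cq cr (reduce_cat_rev_walk _)).
have [t ->] := expi_surj (chi_walk_norm (q v0)).
by rewrite mulrCA expi_conjK mulr1.
Qed.

End Characters.
Theorem theorem7p8 (R : realType) (G : quantumGraph R) (v0 : vertex G) :
  exists chi_ : dR_torus G -> (fundamental_group v0 -> R[i]),
    [/\ forall (a : one_form G) (g : fundamental_group v0),
          chi_ (torus_class a) g = expi (- (2 * pi * loop_integral a g)),
        set_bij [set: dR_torus G]
          [set chi : fundamental_group v0 -> R[i] | is_unitary_character chi] chi_,
        forall a : one_form G,
          character_spectrum (chi_ (torus_class a)) = form_spectrum a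
      & forall c : dR_torus G, bloch_spectrum c = character_spectrum (chi_ c)].
Proof.
have connected := @qconnected _ G.
exists (fun c => holonomy (repr (repr c))).
have chiE a : holonomy (v0 := v0) (repr (repr (torus_class a))) = holonomy a.
  by apply/holonomy_eq => //; exact: torus_class_surj.
split.
- by move=> a g; rewrite chiE.
- split=> [c _|c c' _ _|chi chiU].
  + exact: holonomy_unitary.
  + by move/(holonomy_eq _ _ _ connected); rewrite !torus_class_surj.
  + have [a aE] := character_holonomy connected chiU.
    by exists (torus_class a); rewrite ?chiE.
- by move=> a; rewrite chiE; exact: character_form_spectrum.
- by move=> c; rewrite character_form_spectrum.
Qed.
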